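(* Let $1<p<\infty$ and $0<s<1$. If $\Omega\subset\mathbb{R}^N$ is an open bounded convex set, then for every $u\in C^\infty_0(\Omega)$ we have $$\|u\|^p_{\mathcal{X}^{s,p}_0(\Omega)}\le C\,\|u\|^p_{\mathcal{D}_0^{s,p}(\Omega)},$$ for a constant $C=C(N,p,\mathcal{E}(\Omega))>0$ depending only on $N$, $p$ and the eccentricity $\mathcal{E}(\Omega)$. In particular, $\mathcal{X}^{s,p}_0(\Omega)=\mathcal{D}^{s,p}_0(\Omega)$.
   Context: $C^\infty_0(\Omega)$ is the space of smooth functions with compact support in $\Omega$ (extended by $0$ to $\mathbb{R}^N$). For an open bounded set $\Omega$, the inradius is $R_\Omega=\sup_{x\in\Omega}\mathrm{dist}(x,\partial\Omega)$ and the eccentricity is $\mathcal{E}(\Omega)=\dfrac{\mathrm{diam}(\Omega)}{2R_\Omega}$. For $u\in C_0^\infty(\Omega)$ set $$\|u\|_{\mathcal{D}^{s,p}_0(\Omega)}:=[u]_{W^{s,p}(\mathbb{R}^N)}:=\left(\iint_{\mathbb{R}^N\times\mathbb{R}^N}\frac{|u(x)-u(y)|^p}{|x-y|^{N+sp}}\,dx\,dy\right)^{1/p},$$ and let $\mathcal{D}^{s,p}_0(\Omega)$ be the completion of $C^\infty_0(\Omega)$ with respect to this norm. For $t>0$ and $u\in C_0^\infty(\Omega)$ the $K$-functional is $$K(t,u,L^p(\Omega),\mathcal{D}^{1,p}_0(\Omega)):=\inf_{v\in C^\infty_0(\Omega)}\Big\{\|u-v\|_{L^p(\Omega)}+t\,\|\nabla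 v\|_{L^p(\Omega)}\Big\},$$ and $$\|u\|_{\mathcal{X}^{s,p}_0(\Omega)}:=\left(\int_0^{+\infty}\left(\frac{K(t,u,L^p(\Omega),\mathcal{D}^{1,p}_0(\Omega))}{t^s}\right)^p\frac{dt}{t}\right)^{1/p}.$$ $\mathcal{X}^{s,p}_0(\Omega)$ is the completion of $C_0^\infty(\Omega)$ with respect to this norm. The equality $\mathcal{X}^{s,p}_0(\Omega)=\mathcal{D}^{s,p}_0(\Omega)$ means that the two norms are equivalent on $C^\infty_0(\Omega)$, so that the completions coincide. *)

(* Defs.v *)
From HB Require Import structures.
From mathcomp Require Import all_boot all_order all_algebra.
From mathcomp Require Import all_classical all_reals all_analysis.

Set Implicit Arguments.
Unset Strict Implicit.
Unset Printing Implicit Defensive.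

Import Order.TTheory GRing.Theory Num.Theory.
Import numFieldNormedType.Exports.

Local Open Scope classical_set_scope.
Local Open Scope ring_scope.

(* The sigma-algebra on row vectors generated by the coordinate functions,
   i.e. the Borel sigma-algebra of R^n. *)
Section measurable_rowvector.
Variables (R : realType) (n : nat).

Definition rv_coord (i : 'I_n) (x : 'rV[R]_n) : measurableTypeR R := x ord0 i.

Let rv_set0 : g_sigma_preimage rv_coord set0.
Proof. exact: sigma_algebra0. Qed.

Let rv_setC A : g_sigma_preimage rv_coord A ->
  g_sigma_preimage rv_coord (~` A).
Proof. exact: sigma_algebraC. Qed.

Let rv_bigcup (F : (set 'rV[R]_n)^nat) :
  (forall i, g_sigma_preimage rv_coord (F i)) ->
  g_sigma_preimage rv_coord (\bigcup_i (F i)).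
Proof. exact: sigma_algebra_bigcup. Qed.

Definition rv_display : measure_display. Proof. exact: default_measure_display. Qed.

HB.instance Definition _ := @isMeasurable.Build rv_display
  'rV[R]_n (g_sigma_preimage rv_coord) rv_set0 rv_setC rv_bigcup.

End measurable_rowvector.


Lemma measurable_rv_coord (R : realType) (n : nat) (i : 'I_n) :
  measurable_fun [set: 'rV[R]_n] (rv_coord i).
Proof.
move=> _ Y mY; rewrite setTI; apply: sub_sigma_algebra => /=.
rewrite -bigcup_seq/=; exists i => /=; first by rewrite mem_index_enum.
by exists Y => //; rewrite setTI.
Qed.

Lemma measurable_fun_rv (d : measure_display) (T : measurableType d)
    (R : realType) (n : nat) (f : T -> 'rV[R]_n) :
  (forall i, measurable_fun setT (rv_coord i \o f)) -> measurable_fun setT f.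
Proof.
move=> mf.
suff H : g_sigma_preimage (@rv_coord R n) `<=`
    [set A | measurable (f @^-1` A)].
  by move=> _ A /H; rewrite setTI.
apply: smallest_sub.
  split => /=.
  - by rewrite preimage_set0.
  - by move=> A mA; rewrite setTD preimage_setC; exact: measurableC.
  - by move=> F mF; rewrite preimage_bigcup; exact: bigcupT_measurable.
rewrite -bigcup_seq => A /= [i _ [B mB <-]].
by rewrite setTI -comp_preimage -[X in measurable X]setTI; exact: mf.
Qed.

Section lebesgue_rv_succ.
Variables (R : realType) (n : nat).
Variable mu : {sigma_finite_measure set 'rV[R]_n -> \bar R}.

Definition rv_cons (p : measurableTypeR R * 'rV[R]_n) : 'rV[R]_n.+1 :=
  row_mx (p.1)%:M p.2.

Definition rv_uncons (x : 'rV[R]_n.+1) : measurableTypeR R * 'rV[R]_n :=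
  (rv_coord ord0 x, rsubmx (x : 'rV[R]_(1 + n))).

Lemma rv_consK : cancel rv_cons rv_uncons.
Proof.
case=> a x; rewrite /rv_uncons /rv_cons /= row_mxKr; congr pair.
rewrite /rv_coord (_ : ord0 = lshift n (ord0 : 'I_1)); last exact/val_inj.
by rewrite (row_mxEl (a%:M : 'M[R]_(1, 1)) x) mxE eqxx mulr1n.
Qed.

Lemma measurable_rv_cons : measurable_fun setT rv_cons.
Proof.
apply: measurable_fun_rv => i.
have Ei : rv_coord i \o rv_cons = fun p : measurableTypeR R * 'rV[R]_n =>
    row_mx (p.1)%:M p.2 ord0 (i : 'I_(1 + n)) by [].
case: (split_ordP (i : 'I_(1 + n))) => j ij; rewrite Ei ij.
  under eq_fun do rewrite row_mxEl !ord1 mxE eqxx mulr1n.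
  exact: measurable_fst.
under eq_fun do rewrite row_mxEr.
apply: (measurableT_comp (measurable_rv_coord j)); exact: measurable_snd.
Qed.

Lemma measurable_rv_uncons : measurable_fun setT rv_uncons.
Proof.
apply/measurable_fun_pairP; split; first exact: measurable_rv_coord.
apply: measurable_fun_rv => i.
rewrite (_ : _ \o _ = rv_coord (rshift 1 i)); first exact: measurable_rv_coord.
by apply/funext => x; rewrite /rv_coord /= mxE.
Qed.

Definition lebesgue_rv_succ : set 'rV[R]_n.+1 -> \bar R :=
  pushforward (lebesgue_measure \x mu)%E rv_cons.

Let succ0 : lebesgue_rv_succ set0 = 0%E.
Proof. by rewrite /lebesgue_rv_succ /pushforward preimage_set0 measure0. Qed.

Let succ_ge0 A : (0 <= lebesgue_rv_succ A)%E.
Proof. by apply: measure_ge0; exact: measurable_rv_cons. Qed.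

Let succ_sigma_additive : semi_sigma_additive lebesgue_rv_succ.
Proof.
apply: measure_semi_sigma_additive; exact: measurable_rv_cons.
Qed.

HB.instance Definition _ := isMeasure.Build _ _ _ lebesgue_rv_succ
  succ0 succ_ge0 succ_sigma_additive.

Let succ_sigma_finite : sigma_finite setT lebesgue_rv_succ.
Proof.
have [F TF mF] : sigma_finite setT (lebesgue_measure \x mu)%E.
  have /sigma_finiteP[F [TF ndF Foo]] := sigma_finiteT (@lebesgue_measure R).
  have /sigma_finiteP[G [TG ndG Goo]] := sigma_finiteT mu.
  exists (fun k => F k `*` G k).
    rewrite -setXTT TF TG predeqE => -[x y]; split.
      move=> [/= [k _ Fkx] [l _ Gly]]; exists (maxn k l) => //; split.
      - by move: x Fkx; exact/subsetPset/ndF/leq_maxl.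
      - by move: y Gly; exact/subsetPset/ndG/leq_maxr.
    by move=> [k _ []/= ? ?]; split; exists k.
  move=> k; have [? ?] := Foo k; have [? ?] := Goo k.
  split; first exact: measurableX.
  by rewrite product_measure1E// lte_mul_pinfty// ge0_fin_numE.
exists (fun k => rv_uncons @^-1` F k); first by rewrite -preimage_bigcup -TF.
move=> k; have [mFk Fk] := mF k; split.
  rewrite -[X in measurable X]setTI; exact: measurable_rv_uncons.
rewrite /lebesgue_rv_succ /pushforward -comp_preimage.
by rewrite (_ : _ \o _ = id) //; apply/funext => p; exact: rv_consK.
Qed.

HB.instance Definition _ := Measure_isSigmaFinite.Build _ _ _ lebesgue_rv_succ
  succ_sigma_finite.
End lebesgue_rv_succ.

Fixpoint lebesgue_rv (R : realType) (n : nat) :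
    {sigma_finite_measure set 'rV[R]_n -> \bar R} :=
  match n with
  | 0 => \d_(0 : 'rV[R]_0)
  | m.+1 => lebesgue_rv_succ (lebesgue_rv R m)
  end.


Section euclidean_geometry.
Variables (R : realType) (N : nat).
Implicit Types Omega : set 'rV[R]_N.

(* The norm that the library puts on row vectors is the sup norm; it induces
   the same topology and the same bounded sets as the Euclidean norm. *)
Definition enorm (x : 'rV[R]_N) : R := Num.sqrt (\sum_(i < N) x ord0 i ^+ 2).

Definition boundary Omega : set 'rV[R]_N := closure Omega `\` interior Omega.

Definition edist_set (x : 'rV[R]_N) (A : set 'rV[R]_N) : R :=
  inf [set enorm (x - y) | y in A].

Definition inradius Omega : R :=
  sup [set edist_set x (boundary Omega) | x in Omega].

Definition diam Omega : R :=
  sup [set enorm (z.1 - z.2) | z in Omega `*` Omega].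

Definition eccentricity Omega : R := diam Omega / (2 * inradius Omega).

End euclidean_geometry.

Section function_spaces.
Variables (R : realType) (N : nat).
Implicit Types (Omega : set 'rV[R]_N) (u v : 'rV[R]_N -> R).
Local Open Scope ereal_scope.

Definition partial_deriv (i : 'I_N) u : 'rV[R]_N -> R :=
  fun x => 'D_(delta_mx ord0 i) u x.

Definition gradient u (x : 'rV[R]_N) : 'rV[R]_N :=
  \row_(i < N) partial_deriv i u x.

Fixpoint class_C (k : nat) u : Prop :=
  match k with
  | 0 => continuous u
  | l.+1 => [/\ continuous u,
               forall i x, derivable u x (delta_mx ord0 i) &
               forall i, class_C l (partial_deriv i u)]
  end.

Definition smooth u : Prop := forall k, class_C k u.

Definition tsupport u : set 'rV[R]_N := closure [set x | u x != 0%R].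

(* Elements of C^oo_0(Omega) are represented by their extension by 0 to R^N. *)
Definition C0oo Omega : set ('rV[R]_N -> R) :=
  [set u | [/\ smooth u, compact (tsupport u) & tsupport u `<=` Omega]].

Definition Lp_norm (p : R) Omega u : \bar R :=
  Lnorm (lebesgue_rv R N) p%:E ((EFin \o u) \_ Omega).

(* On the diagonal the integrand is 0 * 0^-1 = 0. *)
Definition Dsp_norm (s p : R) u : \bar R :=
  (\int[lebesgue_rv R N \x lebesgue_rv R N]_z
    (`|u z.1 - u z.2| `^ p / enorm (z.1 - z.2) `^ (N%:R + s * p))%:E)
  `^ p^-1.

Definition K_functional (p : R) Omega (t : R) u : \bar R :=
  ereal_inf [set Lp_norm p Omega (u \- v)%R +
                 t%:E * Lp_norm p Omega (fun x => enorm (gradient v x))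
            | v in C0oo Omega].

Definition Xsp_norm (s p : R) Omega u : \bar R :=
  (\int[lebesgue_measure]_(t in `]0%R, +oo[)
    ((K_functional p Omega t u * ((t `^ s)^-1)%:E) `^ p * (t^-1)%:E))
  `^ p^-1.

Definition equivalent_norms (F : set ('rV[R]_N -> R))
    (nu1 nu2 : ('rV[R]_N -> R) -> \bar R) : Prop :=
  exists2 c : R, (0 < c)%R &
    forall u, F u -> nu1 u <= c%:E * nu2 u /\ nu2 u <= c%:E * nu1 u.

End function_spaces.

(* Main.v *)
Require Import Defs.
From HB Require Import structures.
From mathcomp Require Import all_boot all_order all_algebra.
From mathcomp Require Import all_classical all_reals all_analysis.
From mathcomp Require Import measurable_realfun.
From mathcomp Require Import ring lra.

Set Implicit Arguments.
Unset Strict Implicit.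
Unset Printing Implicit Defensive.

Import Order.TTheory GRing.Theory Num.Theory.
Import numFieldNormedType.Exports.

Local Open Scope classical_set_scope.
Local Open Scope ring_scope.

(* With [mu] the Lebesgue measure, everything rests on the local estimate
     K(t, u)^p <= C t^-N \int\int_{|x - y| <= M t} |u(x) - u(y)|^p dx dy
   for all t > 0, with C and M depending on N, p and the eccentricity only:
   integrating it against t^(-s p - 1) dt and exchanging the integrals produces
   the kernel |x - y|^(-N - s p).
   Let r be the inradius, reached up to a factor 2 at x0. If t is small with
   respect to r, the competitor v is u composed with the dilation of ratio
   k = 1 + O(t / r) about x0 and then mollified at scale t: convexity puts the
   support of v inside Omega, and the dilation moves the points of Omega by
   O(t diam / r), that is, by O(t) times the eccentricity. If t is large, v = 0
   is good enough: u(y) = 0 for y in a cube of size O(t) away from Omega.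
   Conversely, splitting u = (u - v) + v gives, up to a constant,
     \int |u(x + h) - u(x)|^p dx <= K(|h|, u)^p;
   since K is nondecreasing in t, K(|h|, u)^p / |h|^(N + s p) is at most a
   multiple of the integral of t^-N (K(t, u) / t^s)^p / t over |h| < t <= 2|h|,
   and {h : |h| <= t} has measure O(t^N). *)

(** * Borel sets and Lebesgue measure on row vectors *)

(** Mollifying alone would push the support of [u] out of [Omega]. After a dilation about [x0], a
    point of the support of [v] has the form [(1 - th) w + th z] with [w] in the support of [u] and
    [z] in a ball about [x0] contained in [Omega], provided [th r] is a large enough multiple of
    [t]; convexity keeps such a point in [Omega]. All else about the domain is a bound on how far
    points are moved. The kernel is an explicit tent, merely Lipschitz: [v] inherits its smoothness
    from [u], while the size of its gradient comes from the slope [1 / t] of the kernel. Both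
    [|u - v|] and [t |grad v|] are thus dominated by one local mean of differences of [u], to which
    Jensen applies. In the first inequality [s] enters only through the integral of
    [t^(-N - s p - 1)] over a half-line and through a power of [M]; since [1 <= N + s p <= N + p],
    the constants they produce are free of [s]. Measures are computed on cubes, the balls of the sup
    norm, while the statement uses the Euclidean norm; passing from one to the other costs factors
    [N]. *)

Section rv_norm.
Variables (R : realType) (N : nat).
Implicit Types x y : 'rV[R]_N.

Lemma ler_coord_norm x i : `|x ord0 i| <= `|x|.
Proof.
rewrite -[`|x|]/(mx_norm x) mx_normrE; apply/bigmax_geP; right => /=.
by exists (ord0, i).
Qed.

Lemma rv_norm_le x a : 0 <= a -> (forall i, `|x ord0 i| <= a) -> `|x| <= a.
Proof.
move=> a0 xa; rewrite -[`|x|]/(mx_norm x) mx_normrE; apply/bigmax_leP; split => //.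
by move=> -[j i] _ /=; rewrite ord1.
Qed.

Lemma rv_norm_leP x a : 0 <= a -> `|x| <= a <-> forall i, `|x ord0 i| <= a.
Proof.
move=> a0; split; last exact: rv_norm_le.
by move=> xa i; exact: le_trans (ler_coord_norm x i) xa.
Qed.

Lemma normr_delta_le (i : 'I_N) : `|delta_mx ord0 i : 'rV[R]_N| <= 1.
Proof.
apply: rv_norm_le => // j; rewrite mxE eqxx /=.
by case: (j == i); rewrite ?normr1 ?normr0.
Qed.

Lemma rv_ballP x y (e : R) : ball x e y <-> `|x - y| < e.
Proof. by rewrite -ball_normE. Qed.

End rv_norm.

Section rv_measurable.
Variables (R : realType) (N : nat).

Lemma measurable_rv_box (a b : 'I_N -> R) :
  measurable [set x : 'rV[R]_N | forall i, x ord0 i \in `]a i, b i[].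
Proof.
rewrite (_ : [set _ | _] =
    \bigcap_(i in [set: 'I_N]) (@rv_coord R N i @^-1` `]a i, b i[)); last first.
  by apply/seteqP; split => x /= xab i; [move=> _; exact: xab|exact: xab].
apply: fin_bigcap_measurable => [|i _]; first exact: finite_finset.
rewrite -[X in measurable X]setTI; apply: (measurable_rv_coord i) => //.
Qed.

(* An open set is the union of the cubes with centre [z / n.+1], [z] integral,
   and half-width [1 / n.+1] that it contains. *)
Lemma open_measurable_rv (A : set 'rV[R]_N) : open A -> measurable A.
Proof.
move=> oA.
pose B (q : nat * 'rV[int]_N) : set 'rV[R]_N :=
  [set x | forall i, x ord0 i \in
     `](q.2 ord0 i)%:~R / q.1.+1%:R - q.1.+1%:R^-1,
       (q.2 ord0 i)%:~R / q.1.+1%:R + q.1.+1%:R^-1[].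
pose D (q : nat * 'rV[int]_N) : set 'rV[R]_N :=
  if asbool (B q `<=` A) then B q else set0.
suff -> : A = \bigcup_q D q.
  apply: countable_bigcupT_measurable => [|q]; first exact: (@countableP _ [set: nat * 'rV[int]_N]).
  by rewrite /D; case: ifP => // _; exact: measurable_rv_box.
apply/seteqP; split => [x Ax|x [q _]]; last first.
  by rewrite /D; case: asboolP => // BA /BA.
have [e /= e0 xeA] : exists2 e : R, 0 < e & ball x e `<=` A.
  by have /nbhs_ballP[e /= e0 xe] := oA _ Ax; exists e.
have [n _ /(_ n (leqnn n)) ne] := near_infty_natSinv_lt (PosNum e0 : {posnum R}).
(* The mesh is chosen so that [m.+1 = 2 * n.+1]: a cube of half-width [m.+1%:R^-1] that contains [x]
   has side [n.+1%:R^-1 < e], hence lies in the ball of [xeA]. *)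
pose m := (2 * n.+1)%N.-1.
have mE : m.+1%:R = 2 * n.+1%:R :> R by rewrite /m prednK ?muln_gt0// natrM.
have n0 : (0 : R) < n.+1%:R by rewrite ltr0n.
pose z : 'rV[int]_N := \row_i Num.floor (x ord0 i * m.+1%:R).
have zE i : (z ord0 i)%:~R / m.+1%:R <= x ord0 i <
    (z ord0 i)%:~R / m.+1%:R + m.+1%:R^-1.
  have m0 : (0 : R) < m.+1%:R by rewrite ltr0n.
  have := Num.Theory.floor_itv (x ord0 i * m.+1%:R).
  rewrite intrD1 => /andP[zl zr].
  rewrite mxE ler_pdivrMr// zl /= -[X in _ + X]mul1r -mulrDl ltr_pdivlMr//.
have minv : (0 : R) < m.+1%:R^-1 by rewrite invr_gt0 ltr0n.
exists (m, z) => //; rewrite /D asboolT.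
  move=> i /=; rewrite in_itv /=; have /andP[zl zr] := zE i.
  by rewrite zr andbT (lt_le_trans _ zl)// ltrBlDr ltrDl.
move=> y /= By; apply: xeA; apply/rv_ballP.
apply: (@le_lt_trans _ _ n.+1%:R^-1) => //.
apply: rv_norm_le; first by rewrite invr_ge0 ltW.
move=> i; rewrite !mxE; have := By i; rewrite in_itv /=.
have /andP[zl zr] := zE i.
have E : n.+1%:R^-1 = 2 * m.+1%:R^-1 :> R by rewrite mE invfM mulrA divff ?mul1r.
rewrite E ler_norml /=.
move=> /andP[yl yr]; move: zl zr yl yr.
set h := (m.+1%:R^-1 : R); set w := (z ord0 i)%:~R * h.
move: h w (x ord0 i) (y ord0 i) => h w c d; clear => zl zr yl yr.
by apply/andP; split; lra.
Qed.

Lemma continuous_measurable_rv (f : 'rV[R]_N -> R) :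
  continuous f -> measurable_fun setT f.
Proof.
move=> /continuousP cf; apply: (measurability (@RGenOpens.G R)).
  exact: RGenOpens.measurableE.
move=> _ [_ [a [b ->] <-]]; rewrite setTI; apply: open_measurable_rv.
by apply: cf; exact: interval_open.
Qed.

Lemma measurable_normr_rv : measurable_fun setT (fun x : 'rV[R]_N => `|x|).
Proof. by apply: continuous_measurable_rv => x; exact: norm_continuous. Qed.

Lemma measurable_fun_rvD d (T : measurableType d) (f g : T -> 'rV[R]_N) :
  measurable_fun setT f -> measurable_fun setT g ->
  measurable_fun setT (fun t => f t + g t).
Proof.
move=> mf mg; apply: measurable_fun_rv => i.
rewrite (_ : _ \o _ = fun t => rv_coord i (f t) + rv_coord i (g t)).
  by apply: measurable_funD; exact: (measurableT_comp (measurable_rv_coord i)).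
by apply/funext => t; rewrite /rv_coord /= mxE.
Qed.

Lemma measurable_fun_rvZ d (T : measurableType d) (k : R) (f : T -> 'rV[R]_N) :
  measurable_fun setT f -> measurable_fun setT (fun t => k *: f t).
Proof.
move=> mf; apply: measurable_fun_rv => i.
rewrite (_ : _ \o _ = fun t => k * rv_coord i (f t)).
  apply: measurable_funM => //.
  exact: (measurableT_comp (measurable_rv_coord i)).
by apply/funext => t; rewrite /rv_coord /= mxE.
Qed.

Lemma measurable_fun_rvB d (T : measurableType d) (f g : T -> 'rV[R]_N) :
  measurable_fun setT f -> measurable_fun setT g ->
  measurable_fun setT (fun t => f t - g t).
Proof.
move=> mf mg; under eq_fun do rewrite -scaleN1r.
exact/measurable_fun_rvD/measurable_fun_rvZ.
Qed.

Lemma measurable_enorm : measurable_fun setT (@enorm R N).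
Proof.
have -> : @enorm R N = (fun x => x `^ 2^-1) \o
    (fun x => \sum_(i < N) rv_coord i x ^+ 2).
  apply/funext => x; rewrite /= /enorm -powR12_sqrt//.
  by apply: sumr_ge0 => i _; rewrite sqr_ge0.
apply: (measurableT_comp (measurable_powR _)).
apply: measurable_sum => i; apply: measurable_funX; exact: measurable_rv_coord.
Qed.

End rv_measurable.

(** * Affine changes of variables, on the line and on row vectors *)

Section affine_real.
Variable R : realType.
Local Open Scope ereal_scope.
Local Notation leb := (@lebesgue_measure R).

(** Uniqueness of Lebesgue measure: as a function of [A], the right-hand side is a scaled
    push-forward that gives each half-open interval its length. *)
Lemma lebesgue_measure_affine (a b : R) (A : set R) : (0 < a)%R ->
  measurable A ->
  leb A = a%:E * leb ((fun x : R => a * x + b)%R @^-1` A).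
Proof.
move=> a0 mA.
have mphi : measurable_fun [set: measurableTypeR R]
    (fun x : measurableTypeR R => (a * x + b)%R : measurableTypeR R).
  by apply: measurable_funD => //; apply: measurable_funM.
pose m := mscale (NngNum (ltW a0)) (pushforward leb
  (fun x : measurableTypeR R => (a * x + b)%R : measurableTypeR R)).
rewrite -[RHS]/(m mphi A) /m; apply: lebesgue_measure_unique => // _ [[c e]] _ <-.
rewrite [RHS](_ : _ = a%:E * leb [set` `](c - b)%R / a, (e - b)%R / a]%R]); last first.
  congr (_ * leb _).
  apply/seteqP; split => x /=; rewrite !in_itv /= ltr_pdivrMr// ler_pdivlMr//;
    rewrite ltrBlDr lerBrDr mulrC //.
rewrite !lebesgue_measure_itv /= !lte_fin ltr_pM2r ?invr_gt0// ltrD2r.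
case: ifPn => ce; last by rewrite mule0.
by rewrite -!EFinB -EFinM; congr EFin; field; rewrite gt_eqF.
Qed.

Lemma ge0_integral_affine (a b : R) (f : R -> \bar R) : (0 < a)%R ->
  measurable_fun setT f -> (forall x, 0 <= f x) ->
  \int[leb]_x f x = a%:E * \int[leb]_x f (a * x + b)%R.
Proof.
move=> a0 mf f0.
have mphi : measurable_fun [set: measurableTypeR R]
    (fun x : measurableTypeR R => (a * x + b)%R : measurableTypeR R).
  by apply: measurable_funD => //; apply: measurable_funM.
pose phi := fun x : measurableTypeR R => (a * x + b)%R : measurableTypeR R.
have := @ge0_integral_pushforward _ _ _ _ _ phi mphi leb setT f measurableT mf
  (fun y _ => f0 y).
rewrite preimage_setT => <-.
rewrite -[a in a%:E]/((NngNum (ltW a0))%:num) -ge0_integral_mscale//.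
by apply: eq_measure_integral => A mA _; exact: lebesgue_measure_affine.
Qed.

End affine_real.

Section rv_integral.
Variable R : realType.
Local Open Scope ereal_scope.

Lemma ge0_integral_rvS n (f : 'rV[R]_n.+1 -> \bar R) :
  measurable_fun setT f -> (forall x, 0 <= f x) ->
  \int[lebesgue_rv R n.+1]_x f x =
  \int[lebesgue_measure]_a \int[lebesgue_rv R n]_y f (rv_cons (a, y)).
Proof.
move=> mf f0.
have mc := @measurable_rv_cons R n.
rewrite [LHS](_ : _ = \int[pushforward (lebesgue_measure \x lebesgue_rv R n) (@rv_cons R n)]_x f x)//.
rewrite ge0_integral_pushforward//= fubini_tonelli1//.
exact: (measurableT_comp mf mc).
Qed.

Lemma rv_cons_affine n (k : R) (b : 'rV[R]_n.+1) a y :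
  (k *: rv_cons (a, y) + b = rv_cons ((k * a + (rv_uncons b).1)%R,
     (k *: y + (rv_uncons b).2)%R))%R.
Proof.
apply/rowP => i; rewrite /rv_cons /rv_uncons !mxE /=.
case: (split_ordP (i : 'I_(1 + n))) => j ij; rewrite ij !mxE ?ord1 ?eqxx ?mulr1n //.
by rewrite /rv_coord; congr (_ + b _ _)%R; exact/val_inj.
Qed.

Lemma measurable_rv_affine n (k : R) (b : 'rV[R]_n) :
  measurable_fun setT (fun x : 'rV[R]_n => (k *: x + b)%R).
Proof. by apply: measurable_fun_rvD => //; apply: measurable_fun_rvZ. Qed.

(** Induction on the dimension: through [rv_cons] the map acts separately on the first coordinate
    and on the others, and each coordinate contributes one factor [k]. *)
Lemma ge0_integral_rv_affine n (k : R) (b : 'rV[R]_n) (f : 'rV[R]_n -> \bar R) :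
  (0 < k)%R -> measurable_fun setT f -> (forall x, 0 <= f x) ->
  \int[lebesgue_rv R n]_x f x =
  (k ^+ n)%:E * \int[lebesgue_rv R n]_x f (k *: x + b)%R.
Proof.
move=> k0; elim: n => [|n ih] in b f *; move=> mf f0.
  rewrite expr0 mul1e; apply: eq_integral => x _.
  by congr f; apply/rowP => -[].
have mc := @measurable_rv_cons R n.
rewrite ge0_integral_rvS// ge0_integral_rvS//; last first.
  exact: (measurableT_comp mf (measurable_rv_affine k b)).
pose F (a : R) := \int[lebesgue_rv R n]_y f (rv_cons (a, y)).
have mF : measurable_fun setT F.
  apply: (@measurable_fun_fubini_tonelli_F _ _ _ _ _ (lebesgue_rv R n) (f \o @rv_cons R n)).
    exact: (measurableT_comp mf mc).
  by move=> x; exact: f0.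
have F0 a : 0 <= F a by apply: integral_ge0.
rewrite (ge0_integral_affine (rv_uncons b).1 k0 mF F0).
rewrite exprS EFinM -muleA; congr (_ * _).
rewrite -ge0_integralZl//; last 3 first.
- apply: (@measurable_fun_fubini_tonelli_F _ _ _ _ _ (lebesgue_rv R n)
    (fun x => f (k *: rv_cons x + b)%R)); last by move=> x; exact: f0.
  by apply: (measurableT_comp mf); apply: (measurableT_comp (@measurable_rv_affine n.+1 k b)).
- by move=> a _; apply: integral_ge0.
- by rewrite lee_fin exprn_ge0// ltW.
apply: eq_integral => a _; rewrite /F.
rewrite (ih (rv_uncons b).2)//; last first.
  apply: (measurableT_comp mf); apply: (measurableT_comp mc).
  exact: measurable_pair1.
by congr (_ * _); apply: eq_integral => y _; rewrite rv_cons_affine.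
Qed.

Lemma integral_rvD n (b : 'rV[R]_n) (f : 'rV[R]_n -> \bar R) :
  measurable_fun setT f ->
  \int[lebesgue_rv R n]_x f (x + b)%R = \int[lebesgue_rv R n]_x f x.
Proof.
(* The change of variables is available for nonnegative integrands, so the two parts of [f] are
   translated separately. *)
move=> mf; rewrite integralE [in RHS]integralE.
have T (g : 'rV[R]_n -> \bar R) : measurable_fun setT g -> (forall x, 0 <= g x) ->
    \int[lebesgue_rv R n]_x g (x + b)%R = \int[lebesgue_rv R n]_x g x.
  move=> mg g0; rewrite (ge0_integral_rv_affine b ltr01 mg g0) expr1n mul1e.
  by apply: eq_integral => x _; rewrite scale1r.
have mp : measurable_fun setT f^\+ by exact: measurable_funepos.
have mn : measurable_fun setT f^\- by exact: measurable_funeneg.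
congr (_ - _).
  rewrite -(T _ mp) => [|x]; last exact: funepos_ge0.
  by apply: eq_integral => x _; rewrite !funeposE.
rewrite -(T _ mn) => [|x]; last exact: funeneg_ge0.
by apply: eq_integral => x _; rewrite !funenegE.
Qed.

Lemma lebesgue_rv_cube n (a : R) : (0 <= a)%R ->
  lebesgue_rv R n [set x | `|x| <= a]%R = ((2 * a) ^+ n)%:E.
Proof.
move=> a0; elim: n => [|n ih].
  rewrite expr0 /= diracE mem_set//=.
  by rewrite normr0.
rewrite [LHS](_ : _ = (lebesgue_measure \x lebesgue_rv R n)
  ((@rv_cons R n) @^-1` [set x | `|x| <= a]%R))//.
rewrite (_ : _ @^-1` _ = [set` `[(- a)%R, a]%R] `*` [set x : 'rV[R]_n | `|x| <= a]%R).
  rewrite product_measure1E//; last first.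
    rewrite (_ : [set _ | _] = (fun x : 'rV[R]_n => `|x|%R) @^-1` `]-oo, a]).
      by rewrite -[X in measurable X]setTI; exact: measurable_normr_rv.
    by apply/seteqP; split => x /=; rewrite in_itv.

  rewrite exprS EFinM; congr (_ * _)%E; last exact: ih.
  transitivity (lebesgue_measure [set` `[(- a)%R, a]%R]) => //.
  rewrite lebesgue_measure_itv /= lte_fin.
  case: ifPn => a1; first by rewrite -EFinB opprK mulr_natl mulr2n.
  by congr EFin; lra.
apply/seteqP; split => [[c y]/= /(rv_norm_leP _ a0) ca|[c y]/= [ca ya]].
  split; last first.
    apply/(rv_norm_leP _ a0) => i; have := ca (rshift 1 i).
    by rewrite [rv_cons _ _ _](row_mxEr (c%:M : 'M[R]_(1, 1)) y).
  have := ca (lshift n (ord0 : 'I_1)).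
  rewrite [rv_cons _ _ _](row_mxEl (c%:M : 'M[R]_(1, 1)) y) mxE eqxx mulr1n.
  by rewrite ler_norml in_itv.
apply/(rv_norm_leP _ a0) => i; rewrite /rv_cons /=.
case: (split_ordP (i : 'I_(1 + n))) => j ->.
  rewrite (row_mxEl (c%:M : 'M[R]_(1, 1)) y) (ord1 j) mxE eqxx mulr1n ler_norml.
  by move: ca; rewrite in_itv.
rewrite (row_mxEr (c%:M : 'M[R]_(1, 1)) y).
exact: le_trans (ler_coord_norm _ _) ya.
Qed.

End rv_integral.

(** * Powers and the seminorms *)

Section powers.
Variable R : realType.
Implicit Types (a b p : R) (x y : \bar R).

Lemma ler_powR_base p a b : 0 <= p -> 0 <= a -> a <= b -> a `^ p <= b `^ p.
Proof.
by move=> p0 a0 ab; apply: ge0_ler_powR => //; rewrite nnegrE ?(le_trans a0).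
Qed.

Lemma lee_poweR_base p x y :
  0 <= p -> (0 <= x -> x <= y -> x `^ p <= y `^ p)%E.
Proof.
move=> p0 x0 xy; apply: gt0_ler_poweR => //; rewrite in_itv /= leey ?andbT//.
exact: le_trans xy.
Qed.

(** The sum is at most twice the larger term. This is cruder than convexity of the power, but it
    covers every exponent [p >= 0]. *)
Lemma powRD_le p a b : 0 <= p -> 0 <= a -> 0 <= b ->
  (a + b) `^ p <= 2 `^ p * (a `^ p + b `^ p).
Proof.
move=> p0 a0 b0; wlog ab : a b a0 b0 / a <= b => [H|].
  have [/H|/ltW/H] := leP a b; first exact.
  by rewrite (addrC b a) (addrC (b `^ p)); exact.
have : (a + b) `^ p <= (2 * b) `^ p.
  by apply: ler_powR_base => //; [exact: addr_ge0|lra].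
move=> /le_trans; apply; rewrite powRM// ler_wpM2l ?powR_ge0//.
by rewrite lerDr powR_ge0.
Qed.

Lemma poweRD_le p x y : 0 <= p -> (0 <= x -> 0 <= y ->
  (x + y) `^ p <= (2 `^ p)%:E * (x `^ p + y `^ p))%E.
Proof.
(* At exponent 0 every power is 1, even that of [+oo]; for [p != 0] an infinite term makes the
   right-hand side infinite. *)
move=> p0; have [->|pN0] := eqVneq p 0.
  by move=> _ _; rewrite powRr0 mul1e !poweRe0 -EFinD lee_fin lerDl.
case: x => [a| |]//; case: y => [b| |]// x0 y0; rewrite ?addye ?addey//=.
- by rewrite lee_fin powRD_le.
- by rewrite (negbTE pN0) ?addey ?addye// gt0_muley ?leey ?lte_fin ?powR_gt0.
- by rewrite (negbTE pN0) ?addey ?addye// gt0_muley ?leey ?lte_fin ?powR_gt0.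
- by rewrite (negbTE pN0) ?addey ?addye// gt0_muley ?leey ?lte_fin ?powR_gt0.
Qed.

Lemma poweRVK p x : p != 0 -> (0 <= x -> (x `^ p^-1) `^ p = x)%E.
Proof. by move=> p0 x0; rewrite -poweRrM mulVf// poweRe1. Qed.

Lemma poweRK p x : p != 0 -> (0 <= x -> (x `^ p) `^ p^-1 = x)%E.
Proof. by move=> p0 x0; rewrite -poweRrM mulfV// poweRe1. Qed.

Lemma lee_poweR_inv p x y : 0 < p ->
  (0 <= x -> 0 <= y -> x `^ p <= y `^ p -> x <= y)%E.
Proof.
move=> p0 x0 y0 xy; have pN0 : p != 0 by rewrite gt_eqF.
rewrite -(poweRK pN0 x0) -(poweRK pN0 y0); apply: lee_poweR_base => //.
  by rewrite invr_ge0 ltW.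
exact: poweR_ge0.
Qed.

End powers.

Section jensen.
Context d (T : measurableType d) (R : realType).
Variable mu : {measure set T -> \bar R}.
Local Open Scope ereal_scope.

(** Hölder's inequality between [g] on [D] and the indicator of [D]. The measure on [D] is not
    normalized, hence the power of its mass [M]. *)
Lemma jensen_powR (D : set T) (M p : R) (g : T -> R) : (1 < p)%R ->
  measurable D -> mu D = M%:E -> measurable_fun setT g ->
  (forall x, 0 <= g x)%R ->
  (\int[mu]_(x in D) (g x)%:E) `^ p <=
  (M `^ (p - 1))%:E * \int[mu]_(x in D) (g x `^ p)%:E.
Proof.
move=> p1 mD MD mg g0.
have p0 : (0 < p)%R by lra.
have pN0 : p != 0%R by rewrite gt_eqF.
pose q := (p / (p - 1))%R.
have q0 : (0 < q)%R by rewrite divr_gt0//; lra.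
have pq : (p^-1 + q^-1 = 1)%R by rewrite /q invf_div; field; rewrite pN0.
pose f : T -> R := (g \* \1_D)%R.
pose h : T -> R := \1_D.
have mh : measurable_fun setT h by exact: measurable_indic.
have mf : measurable_fun setT f by exact: measurable_funM.
have := hoelder mu mf mh p0 q0 pq.
rewrite Lnorm1.
have hI x : h x = (x \in D)%:R by rewrite /h indicE.
have -> : \int[mu]_x `|(EFin \o (f \* h)%R) x| = \int[mu]_(x in D) (g x)%:E.
  rewrite [RHS]integral_mkcond; apply: eq_integral => x _ /=.
  rewrite patchE /f /= -/(h x) hI; case: ifPn => _.
    by rewrite !mulr1 ger0_norm.
  by rewrite !mulr0 normr0.
move=> /(lee_poweR_base (ltW p0)) => /(_ (integral_ge0 _ _)) H.
have {H} := H (fun x _ => g0 x).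
rewrite poweRM ?Lnorm_ge0// poweR_Lnorm//.
have -> : \int[mu]_x (`|(EFin \o f) x| `^ p) = \int[mu]_(x in D) (g x `^ p)%:E.
  rewrite [RHS]integral_mkcond; apply: eq_integral => x _ /=.
  rewrite patchE /f /= -/(h x) hI; case: ifPn => _.
    by rewrite !mulr1 ger0_norm.
  by rewrite !mulr0 normr0 powR0.
move=> /le_trans; apply; rewrite muleC.
suff -> : Lnorm mu q%:E (EFin \o h) `^ p = (M `^ (p - 1))%:E by [].
have -> : p = (q * (p - 1))%R by rewrite /q; field; rewrite subr_eq0 gt_eqF.
rewrite poweRrM poweR_Lnorm ?gt_eqF//.
have -> : \int[mu]_x (`|(EFin \o h) x| `^ q) = M%:E.
  rewrite -MD -[D in RHS]setIT -integral_indic//; apply: eq_integral => x _ /=.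
  rewrite -/(h x) hI; case: (x \in D); first by rewrite normr1 powR1.
  by rewrite normr0 powR0 ?gt_eqF.
by rewrite poweR_EFin; congr (_ `^ _)%:E; rewrite /q; field;
  rewrite subr_eq0 gt_eqF.
Qed.

End jensen.

Section seminorms.
Variables (R : realType) (N : nat).
Local Open Scope ereal_scope.
Local Notation mu := (lebesgue_rv R N).
Implicit Types (Omega : set 'rV[R]_N) (u v f : 'rV[R]_N -> R).

Lemma Lp_norm_ge0 p Omega u : 0 <= Lp_norm p Omega u.
Proof. exact: Lnorm_ge0. Qed.

Lemma Lp_norm_poweR p Omega u : (0 < p)%R ->
  Lp_norm p Omega u `^ p = \int[mu]_(x in Omega) (`|u x| `^ p)%:E.
Proof.
move=> p0; rewrite /Lp_norm poweR_Lnorm ?gt_eqF// [RHS]integral_mkcond.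
apply: eq_integral => x _; rewrite !patchE; case: ifPn => //= _.
by rewrite normr0 powR0// gt_eqF.
Qed.

Lemma integral_vanish_out Omega (f : 'rV[R]_N -> \bar R) :
  (forall x, ~ Omega x -> f x = 0) -> \int[mu]_(x in Omega) f x = \int[mu]_x f x.
Proof.
move=> f0; rewrite integral_mkcond; apply: eq_integral => x _.
by rewrite patchE; case: ifPn => // /negP xO; rewrite f0// => /mem_set.
Qed.

Lemma Dsp_norm_ge0 s p u : 0 <= Dsp_norm s p u.
Proof. exact: poweR_ge0. Qed.

Lemma Xsp_norm_ge0 s p Omega u : 0 <= Xsp_norm s p Omega u.
Proof. exact: poweR_ge0. Qed.

Lemma Dsp_norm_poweR s p u : (0 < p)%R ->
  Dsp_norm s p u `^ p = \int[mu \x mu]_z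
    (`|u z.1 - u z.2| `^ p / enorm (z.1 - z.2) `^ (N%:R + s * p))%:E.
Proof.
move=> p0; rewrite poweRVK ?gt_eqF//; apply: integral_ge0 => z _.
by rewrite lee_fin divr_ge0 ?powR_ge0.
Qed.

Lemma K_functional_ge0 p Omega (t : R) u : (0 <= t)%R ->
  0 <= K_functional p Omega t u.
Proof.
move=> t0; apply/ereal_infP => _ [v _ <-].
by rewrite adde_ge0 ?Lp_norm_ge0// mule_ge0 ?Lp_norm_ge0.
Qed.

Lemma Xsp_norm_poweR s p Omega u : (0 < p)%R ->
  Xsp_norm s p Omega u `^ p = \int[lebesgue_measure]_(t in `]0%R, +oo[)
    ((K_functional p Omega t u * ((t `^ s)^-1)%:E) `^ p * (t^-1)%:E).
Proof.
move=> p0; rewrite poweRVK ?gt_eqF//; apply: integral_ge0 => t /=.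
rewrite in_itv /= andbT => t0; apply: mule_ge0; first exact: poweR_ge0.
by rewrite lee_fin invr_ge0 ltW.
Qed.

Lemma K_functional_le p Omega (t : R) u v : C0oo Omega v ->
  K_functional p Omega t u <= Lp_norm p Omega (u \- v)%R +
    t%:E * Lp_norm p Omega (fun x => enorm (gradient v x)).
Proof. by move=> Cv; apply: ge_ereal_inf; eexists; [exists v|exact: lexx]. Qed.

Lemma K_functional_mono p Omega u (t1 t2 : R) : (t1 <= t2)%R ->
  K_functional p Omega t1 u <= K_functional p Omega t2 u.
Proof.
move=> t12; apply/ereal_infP => _ [v Cv <-].
apply: le_trans (K_functional_le _ _ _ Cv) _; apply: leeD => //.
by apply: lee_wpmul2r; rewrite ?Lp_norm_ge0// lee_fin.
Qed.

(** Monotonicity in [t] suffices: the preimages of the generating half-lines are intervals. *)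
Lemma measurable_K_functional p Omega u :
  measurable_fun [set: measurableTypeR R]
    (fun t => K_functional p Omega t u).
Proof.
apply: (measurability (@ErealGenCInfty.G R)); first exact: ErealGenCInfty.measurableE.
move=> _ [_ [r ->] <-]; rewrite setTI.
apply: is_interval_measurable => a b /=.
rewrite !in_itv /= !andbT => ra _ c /andP[ac _].
rewrite in_itv /= andbT; exact: le_trans ra (K_functional_mono _ _ _ ac).
Qed.

End seminorms.

(** * Test functions *)

Section calculus.
Variables (R : realType) (N : nat).
Implicit Types (Omega : set 'rV[R]_N) (u v : 'rV[R]_N -> R) (x h : 'rV[R]_N).
Local Notation e_ i := (delta_mx ord0 i : 'rV[R]_N).

(** This is [C0oo] with the domain forgotten: the estimates below live on the whole space, and
    partial derivatives stay in this class. *)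
Definition test_fun u := smooth u /\ compact (tsupport u).

Lemma C0oo_test_fun Omega u : C0oo Omega u -> test_fun u.
Proof. by case. Qed.

Lemma test_fun_continuous u : test_fun u -> continuous u.
Proof. by move=> [su _]; exact: (su 0%N). Qed.

Lemma test_fun_measurable u : test_fun u -> measurable_fun setT u.
Proof. by move=> /test_fun_continuous; exact: continuous_measurable_rv. Qed.

Lemma tsupport_out u x : ~ tsupport u x -> u x = 0.
Proof.
move=> ux; apply/eqP/negPn/negP => u0; apply: ux; exact: subset_closure.
Qed.

Lemma C0oo_out Omega u x : C0oo Omega u -> ~ Omega x -> u x = 0.
Proof. by move=> [_ _ uO] xO; apply: tsupport_out => /uO. Qed.

Lemma partial_deriv_out u i x : ~ tsupport u x -> partial_deriv i u x = 0.
Proof.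
move=> ux; rewrite /partial_deriv.
have : open (~` tsupport u) by apply: closed_openC; exact: closed_closure.
rewrite openE => /(_ _ ux) /= nx.
rewrite (@near_eq_derive _ _ _ u (cst 0)) ?derive_cst//.
by near=> y; apply: tsupport_out; near: y.
Unshelve. all: end_near. Qed.

Lemma test_fun_partial u i : test_fun u -> test_fun (partial_deriv i u).
Proof.
move=> [su cu]; split; first by move=> k; have [_ _] := su k.+1; exact.
apply: subclosed_compact cu _; first exact: closed_closure.
rewrite [X in _ `<=` X](_ : _ = closure (tsupport u)); last first.
  by apply/closure_id; exact: closed_closure.
apply: closureS => x /= ux; apply: contrapT => /partial_deriv_out H.
by move: ux; rewrite H eqxx.
Qed.

Lemma test_fun_bounded u : test_fun u ->
  exists2 B : R, 0 <= B & forall x, `|u x| <= B.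
Proof.
move=> tu; have [su cu] := tu.
have cU : compact (u @` tsupport u).
  apply: continuous_compact => //; apply: continuous_subspaceT.
  exact: test_fun_continuous.
have [M [_ HM]] := compact_bounded cU.
exists (`|M| + 1); first by rewrite addr_ge0.
move=> x; have [ux|ux] := pselect (tsupport u x); last first.
  by rewrite tsupport_out// normr0 addr_ge0.
apply: (HM (`|M| + 1)); last by exists x.
by rewrite (le_lt_trans (ler_norm _))// ltrDl.
Qed.

Lemma test_fun_derivable u i x : test_fun u -> derivable u x (e_ i).
Proof. by move=> [su _]; have [_ + _] := su 1%N; exact. Qed.

Lemma is_derive_line u i x (t : R) : derivable u (x + t *: e_ i) (e_ i) ->
  is_derive t 1 (fun t => u (x + t *: e_ i)) (partial_deriv i u (x + t *: e_ i)).
Proof.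
move=> du.
have E : (fun h : R => h^-1 *: (((fun t => u (x + t *: e_ i)) \o shift t) (h *: 1)
      - u (x + t *: e_ i))) =
    (fun h : R => h^-1 *: ((u \o shift (x + t *: e_ i)) (h *: e_ i)
      - u (x + t *: e_ i))).
  apply/funext => h /=; congr (_ *: (u _ - _)).
  by rewrite scalerDl addrCA [_%:A]mulr1.
by split; [rewrite /derivable E|rewrite /partial_deriv /derive E].
Qed.

Lemma mean_value_line u i x (t : R) : test_fun u -> exists2 c : R, `|c| <= `|t| &
  u (x + t *: e_ i) - u x = t * partial_deriv i u (x + c *: e_ i).
Proof.
move=> tu.
have H y (r : R) : 0 <= r -> exists2 c : R, 0 <= c <= r &
    u (y + r *: e_ i) - u y = r * partial_deriv i u (y + c *: e_ i).
  move=> r0; pose phi (s : R) := u (y + s *: e_ i).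
  have dphi (s : R) : is_derive s 1 phi (partial_deriv i u (y + s *: e_ i)).
    by apply: is_derive_line; exact: test_fun_derivable.
  have [|c] := @MVT_segment _ phi (fun s => partial_deriv i u (y + s *: e_ i)) 0 r r0.
    apply: continuous_subspaceT => s.
    by apply: differentiable_continuous; apply/derivable1_diffP; case: (dphi s).
  rewrite in_itv /= => c0r; rewrite /phi scale0r addr0 subr0 mulrC => E.
  by exists c.
have [t0|t0] := leP 0 t.
  have [c /andP[c0 ct] E] := H x t t0; exists c => //.
  by rewrite !ger0_norm.
(* For negative [t] the forward case is applied from the other end point [x + t *: e_ i]. *)
have Nt : 0 <= - t by rewrite oppr_ge0 ltW.
have [c /andP[c0 ct] E] := H (x + t *: e_ i) (- t) Nt.
exists (t + c); first by rewrite (ltr0_norm t0) ler_norml; apply/andP; split; lra.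
move: E; rewrite scaleNr addrK -addrA -scalerDl => E.
by rewrite -[LHS]opprB E mulNr opprK.
Qed.

Lemma increment_line_le u i (B : R) : test_fun u ->
  (forall x, `|partial_deriv i u x| <= B) ->
  forall x (t : R), `|u (x + t *: e_ i) - u x| <= B * `|t|.
Proof.
move=> tu uB x t; have [c _ ->] := mean_value_line i x t tu.
by rewrite normrM mulrC ler_wpM2r.
Qed.

Lemma rv_sum_delta h : h = \sum_(i < N) h ord0 i *: e_ i.
Proof. exact: row_sum_delta. Qed.

Lemma test_fun_lipschitz u : test_fun u -> exists2 L : R, 0 <= L &
  forall x h, `|u (x + h) - u x| <= L * `|h|.
Proof.
move=> tu.
have [B HB] : {B : 'I_N -> R & forall i, 0 <= B i /\
    forall x, `|partial_deriv i u x| <= B i}.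
  apply: (@choice _ _ (fun i b => 0 <= b /\ forall x, `|partial_deriv i u x| <= b)).
  by move=> i; have [b b0 ub] := test_fun_bounded (test_fun_partial i tu); exists b.
exists (\sum_i B i); first by apply: sumr_ge0 => i _; case: (HB i).
move=> x h; rewrite {1}(rv_sum_delta h).
(* The increment [h] is walked one coordinate at a time; [x] is generalized because each move starts
   from a new point. *)
elim: (index_enum _) x => [|i r ih] x.
  by rewrite !big_nil addr0 subrr normr0 mul0r.
rewrite !big_cons addrA.
apply: (le_trans (ler_distD (u (x + h ord0 i *: e_ i)) _ _)).
rewrite mulrDl [leRHS]addrC; apply: lerD; first exact: ih.
have [B0 uB] := HB i.
apply: le_trans (increment_line_le tu uB _ _) _.
by rewrite ler_wpM2l// ler_coord_norm.
Qed.

End calculus.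

Section integral_powers.
Context d (T : measurableType d) (R : realType).
Local Open Scope ereal_scope.

Lemma measurable_abs_powR (f : T -> R) (p : R) :
  measurable_fun setT f ->
  measurable_fun setT (fun x => (`|f x| `^ p)%:E).
Proof.
move=> mf; apply/measurable_EFinP; apply: (measurableT_comp (measurable_powR _)).
exact: measurableT_comp.
Qed.

Lemma integral_powRD_le (m : {measure set T -> \bar R})
    (p : R) (f g k : T -> R) : (0 <= p)%R ->
  measurable_fun setT f -> measurable_fun setT g -> measurable_fun setT k ->
  (forall x, `|k x| <= `|f x| + `|g x|)%R ->
  \int[m]_x (`|k x| `^ p)%:E <=
  (2 `^ p)%:E * (\int[m]_x (`|f x| `^ p)%:E + \int[m]_x (`|g x| `^ p)%:E).
Proof.
move=> p0 mf mg mk kfg.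
have mF := measurable_abs_powR p mf; have mG := measurable_abs_powR p mg.
rewrite -ge0_integralD//.
rewrite -ge0_integralZl_EFin ?powR_ge0//; last 2 first.
- by move=> x _; rewrite -EFinD lee_fin addr_ge0 ?powR_ge0.
- exact: emeasurable_funD.
apply: ge0_le_integral => //.
- exact: measurable_abs_powR.
- by apply: measurable_funeM; exact: emeasurable_funD.
move=> x _; rewrite -EFinD -EFinM lee_fin.
apply: (le_trans (ler_powR_base p0 (normr_ge0 _) (kfg x))).
exact: powRD_le.
Qed.

End integral_powers.

(** * The fractional norm is controlled by the K-functional *)

Section tonelli_in.
Context d1 d2 (T1 : measurableType d1) (T2 : measurableType d2) (R : realType).
Variables (m1 : {sigma_finite_measure set T1 -> \bar R})
  (m2 : {sigma_finite_measure set T2 -> \bar R}).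
Local Open Scope ereal_scope.

(** Extending [f] by zero outside [D] reduces this to Tonelli on the full product; the sign of [f]
    matters on [D] only. *)
Lemma tonelli_in (D : set T2) (f : T1 -> T2 -> \bar R) : measurable D ->
  measurable_fun setT (fun z : T1 * T2 => f z.1 z.2) ->
  (forall x y, D y -> 0 <= f x y) ->
  \int[m1]_x \int[m2]_(y in D) f x y = \int[m2]_(y in D) \int[m1]_x f x y.
Proof.
move=> mD mf f0.
pose g := (fun z : T1 * T2 => f z.1 z.2) \_ (setT `*` D).
have mg : measurable_fun setT g.
  apply/(measurable_restrictT _ _).1; first exact: measurableX.
  exact: measurable_funS mf.
have g0 z : 0 <= g z.
  rewrite /g patchE; case: ifPn => // /set_mem [_ /= zD]; exact: f0.
transitivity (\int[m1]_x \int[m2]_y g (x, y)).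
  apply: eq_integral => x _; rewrite integral_mkcond; apply: eq_integral => y _.
  rewrite /g !patchE; congr (if _ then _ else _).
  by apply/idP/idP => /set_mem H; apply/mem_set; [split|case: H].
rewrite fubini_tonelli// [RHS]integral_mkcond; apply: eq_integral => y _.
rewrite patchE; case: ifPn => [yD|yD].
  apply: eq_integral => x _; rewrite /g patchE ifT//.
  by apply/mem_set; split => //; exact: set_mem.
rewrite integral0_eq// => x _; rewrite /g patchE ifF//.
by apply/negP => /set_mem[_ /mem_set]; rewrite (negbTE yD).
Qed.

Lemma measurable_integral_in (D : set T2) (f : T1 -> T2 -> \bar R) : measurable D ->
  measurable_fun setT (fun z : T1 * T2 => f z.1 z.2) ->
  (forall x y, D y -> 0 <= f x y) ->
  measurable_fun setT (fun x => \int[m2]_(y in D) f x y).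
Proof.
move=> mD mf f0.
pose g := (fun z : T1 * T2 => f z.1 z.2) \_ (setT `*` D).
have mg : measurable_fun setT g.
  apply/(measurable_restrictT _ _).1; first exact: measurableX.
  exact: measurable_funS mf.
have g0 z : 0 <= g z.
  rewrite /g patchE; case: ifPn => // /set_mem [_ /= zD]; exact: f0.
rewrite (_ : (fun x => _) = fubini_F m2 g).
  exact: measurable_fun_fubini_tonelli_F.
apply/funext => x; rewrite integral_mkcond; apply: eq_integral => y _.
rewrite /g !patchE; congr (if _ then _ else _).
by apply/idP/idP => /set_mem H; apply/mem_set; [split|case: H].
Qed.

End tonelli_in.

(** * Translation estimates in L^p and their comparison with the K-functional *)

Section shift_energy.
Variables (R : realType) (N : nat).
Local Open Scope ereal_scope.
Local Notation mu := (lebesgue_rv R N).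
Implicit Types (Omega : set 'rV[R]_N) (u v w : 'rV[R]_N -> R) (h x : 'rV[R]_N).
Local Notation e_ i := (delta_mx ord0 i : 'rV[R]_N).

Definition shift_energy p u h : \bar R :=
  \int[mu]_x (`|u (x + h)%R - u x|%R `^ p)%:E.

Lemma measurable_shift u h : measurable_fun setT u ->
  measurable_fun setT (fun x => u (x + h)%R).
Proof. by move=> mu_; apply: (measurableT_comp mu_); exact: measurable_fun_rvD. Qed.

Lemma shift_energy_ge0 p u h : 0 <= shift_energy p u h.
Proof. by apply: integral_ge0 => x _; rewrite lee_fin powR_ge0. Qed.

(** Translate by [h2], then by [h1]: the second increment is based at [x + h2], and translation
    invariance brings it back to [x]. *)
Lemma shift_energyD p u h1 h2 : (0 <= p)%R -> measurable_fun setT u ->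
  shift_energy p u (h1 + h2)%R <=
  (2 `^ p)%:E * (shift_energy p u h1 + shift_energy p u h2).
Proof.
move=> p0 mu_.
have E : shift_energy p u h1 = \int[mu]_x (`|u (x + h2 + h1)%R - u (x + h2)%R|%R `^ p)%:E.
  rewrite /shift_energy.
  rewrite -[LHS](integral_rvD h2 (f := fun x => (`|u (x + h1)%R - u x|%R `^ p)%:E))//.
  apply: measurable_abs_powR; apply: measurable_funB => //.
  exact: measurable_shift.
rewrite E; apply: integral_powRD_le; first exact: p0.
- apply: measurable_funB; last exact: measurable_shift.
  rewrite (_ : (fun x => _) = fun x => u (x + (h2 + h1))%R); last first.
    by apply/funext => x; rewrite addrA.
  exact: measurable_shift.
- by apply: measurable_funB => //; exact: measurable_shift.
- by apply: measurable_funB => //; exact: measurable_shift.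
move=> x; rewrite addrA [(x + h1 + h2)%R]addrAC.
exact: ler_distD.
Qed.

Lemma shift_energy_le_Lp p u h : (0 <= p)%R -> measurable_fun setT u ->
  shift_energy p u h <= (2 `^ p * 2)%:E * \int[mu]_x (`|u x| `^ p)%:E.
Proof.
move=> p0 mu_.
apply: le_trans (integral_powRD_le _ p0 (measurable_shift h mu_) mu_ _ _) _.
- by apply: measurable_funB => //; exact: measurable_shift.
- by move=> x; exact: ler_normB.
rewrite (integral_rvD h (f := fun x => (`|u x| `^ p)%:E)); last exact: measurable_abs_powR.
by rewrite EFinM -muleA -mule2n mule_natl.
Qed.

(** The intermediate point of the mean value theorem would depend on [x] in an uncontrolled way; the
    integral form can be integrated over [x] by Tonelli. *)
Lemma increment_integral u i x (t : R) : test_fun u -> (0 < t)%R ->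
  (`|u (x + t *: e_ i)%R - u x|%:E <=
  \int[lebesgue_measure]_(s in `[0%R, t]) `|partial_deriv i u (x + s *: e_ i)%R|%:E).
Proof.
move=> tu t0.
pose phi (s : R) := u (x + s *: e_ i)%R.
pose f (s : R) := partial_deriv i u (x + s *: e_ i)%R.
have dphi (s : R) : is_derive s 1%R phi (f s).
  by apply: is_derive_line; exact: test_fun_derivable.
have cphi : continuous phi.
  move=> s; apply: differentiable_continuous; apply/derivable1_diffP.
  by case: (dphi s).
have cf : continuous f.
  move=> s; apply: continuous_comp; last first.
    exact: (test_fun_continuous (test_fun_partial i tu)).
  apply: continuousD; first exact: cst_continuous.
  by move=> ?; apply: scalel_continuous.
have := @continuous_FTC2 R f phi 0 t t0.
move=> /(_ _ _ _) H.
have {H} H : \int[lebesgue_measure]_(s in `[0%R, t]) (f s)%:E = (phi t)%:E - (phi 0%R)%:E.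
  apply: H.
  - exact: continuous_subspaceT.
  - split.
    + by move=> s _; case: (dphi s).
    + by apply: cvg_at_right_filter; exact: cphi.
    + by apply: cvg_at_left_filter; exact: cphi.
  - by move=> s _; rewrite derive1E; case: (dphi s).
have mf : measurable_fun setT f by exact: continuous_measurable_fun.
rewrite (_ : `|_|%:E = `|\int[lebesgue_measure]_(s in `[0%R, t]) (f s)%:E|).
  apply: le_abse_integral => //.
  by apply/measurable_EFinP; exact: measurable_funS mf.
by rewrite H /phi scale0r addr0.
Qed.

(** Jensen on the segment of length [t] gives the power [p - 1] of [t]. After the exchange of
    integrals every [s] contributes the same integral, by translation invariance, and this gives the
    last factor [t]. *)
Lemma shift_energy_line_pos p u i (t : R) : (1 < p)%R -> test_fun u -> (0 < t)%R ->
  shift_energy p u (t *: e_ i)%R <=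
  (t `^ p)%:E * \int[mu]_x (`|partial_deriv i u x| `^ p)%:E.
Proof.
move=> p1 tu t0; have p0 : (0 <= p)%R by lra.
have mpu := test_fun_measurable (test_fun_partial i tu).
pose g (x : 'rV[R]_N) (s : R) := (`|partial_deriv i u (x + s *: e_ i)%R| `^ p)%:E.
have mline : measurable_fun setT
    (fun z : 'rV[R]_N * measurableTypeR R => (z.1 + z.2 *: e_ i)%R).
  apply: measurable_fun_rvD; first exact: measurable_fst.
  apply: measurable_fun_rv => j.
  rewrite (_ : _ \o _ = fun z : 'rV[R]_N * measurableTypeR R =>
    (z.2 * (e_ i) ord0 j)%R); last by apply/funext => z; rewrite /rv_coord /= mxE.
  by apply: measurable_funM => //; exact: measurable_snd.
have mg : measurable_fun setT (fun z : 'rV[R]_N * measurableTypeR R => g z.1 z.2).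
  by apply: measurable_abs_powR; exact: (measurableT_comp mpu mline).
have mline2 x : measurable_fun setT (fun s : measurableTypeR R => (x + s *: e_ i)%R).
  exact: (measurableT_comp mline (measurable_pair1 x)).
have g0 x s : 0 <= g x s by rewrite lee_fin powR_ge0.
have mI : measurable [set` `[0%R, t]%R] by exact: measurable_itv.
have muI : (@lebesgue_measure R) [set` `[0%R, t]%R] = t%:E.
  by rewrite lebesgue_measure_itv /= lte_fin t0 oppr0 adde0.
have mG : measurable_fun setT (fun x => \int[lebesgue_measure]_(s in `[0%R, t]) g x s).
  exact: measurable_integral_in.
apply: (@le_trans _ _ (\int[mu]_x ((t `^ (p - 1))%:E *
    \int[lebesgue_measure]_(s in `[0%R, t]) g x s))).
  apply: ge0_le_integral => //.
  - apply: measurable_abs_powR; apply: measurable_funB.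
      exact: measurable_shift (test_fun_measurable tu).
    exact: test_fun_measurable.
  - exact: measurable_funeM.
  move=> x _; rewrite -poweR_EFin.
  apply: le_trans (lee_poweR_base p0 _ (increment_integral i x tu t0)) _ => //.
  apply: jensen_powR => //.
  apply: measurableT_comp => //.
  exact: (measurableT_comp mpu (mline2 x)).
rewrite ge0_integralZl_EFin ?powR_ge0//; last first.
  by move=> x _; apply: integral_ge0.
rewrite tonelli_in//.
rewrite (eq_integral (fun=> \int[mu]_x (`|partial_deriv i u x| `^ p)%:E)); last first.
  move=> s _; rewrite /g.
  apply: (integral_rvD (s *: e_ i)%R (f := fun x => (`|partial_deriv i u x| `^ p)%:E)).
  exact: measurable_abs_powR.
rewrite integral_cst// [X in _ * (_ * X)](_ : _ = t%:E); last exact: muI.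
rewrite muleA [_ * t%:E]muleC muleA -EFinM.
rewrite [X in X%:E * _ <= _](_ : _ = t `^ p)%R//.
by rewrite mulr_powRB1 ?ltW//; lra.
Qed.

Lemma shift_energyN p u h : measurable_fun setT u ->
  shift_energy p u (- h)%R = shift_energy p u h.
Proof.
move=> mu_; rewrite /shift_energy.
rewrite -[RHS](integral_rvD (- h)%R (f := fun x => (`|u (x + h)%R - u x|%R `^ p)%:E)).
  by apply: eq_integral => x _; rewrite subrK distrC.
apply: measurable_abs_powR; apply: measurable_funB => //; exact: measurable_shift.
Qed.

Lemma shift_energy_line p u i (t : R) : (1 < p)%R -> test_fun u ->
  shift_energy p u (t *: e_ i)%R <=
  (`|t| `^ p)%:E * \int[mu]_x (`|partial_deriv i u x| `^ p)%:E.
Proof.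
move=> p1 tu; case: (ltgtP (0 : R)%R t) => [t0|t0|<-].
- by rewrite (gtr0_norm t0); exact: shift_energy_line_pos.
- rewrite -shift_energyN; last exact: test_fun_measurable.
  rewrite -scaleNr (ltr0_norm t0); apply: shift_energy_line_pos => //.
  by rewrite oppr_gt0.
rewrite /shift_energy integral0_eq.
  by apply: mule_ge0; [|apply: integral_ge0 => x _]; rewrite lee_fin powR_ge0.
by move=> x _; rewrite scale0r addr0 subrr normr0 powR0// gt_eqF//; lra.
Qed.

Lemma enorm_ge0 h : (0 <= enorm h)%R.
Proof. exact: sqrtr_ge0. Qed.

Lemma coord_le_enorm h i : (`|h ord0 i| <= enorm h)%R.
Proof.
rewrite /enorm -sqrtr_sqr ler_sqrt; last by apply: sumr_ge0 => j _; exact: sqr_ge0.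
by rewrite (bigD1 i)//= lerDl; apply: sumr_ge0 => j _; exact: sqr_ge0.
Qed.

Lemma normr_le_enorm h : (`|h| <= enorm h)%R.
Proof. by apply: rv_norm_le; [exact: enorm_ge0|move=> i; exact: coord_le_enorm]. Qed.

Lemma measurable_gradient_norm u : test_fun u ->
  measurable_fun setT (fun x => enorm (gradient u x)).
Proof.
move=> tu; apply: (measurableT_comp (@measurable_enorm R N)).
apply: measurable_fun_rv => i.
rewrite (_ : _ \o _ = partial_deriv i u); last first.
  by apply/funext => x; rewrite /rv_coord /gradient /= mxE.
exact: test_fun_measurable (test_fun_partial i tu).
Qed.

Lemma shift_energy_gradient p : (1 < p)%R -> exists2 C : R, (0 < C)%R &
  forall u h, test_fun u -> shift_energy p u h <=
   (C * enorm h `^ p)%:E * \int[mu]_x (`|enorm (gradient u x)| `^ p)%:E.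
Proof.
move=> p1; have p0 : (0 <= p)%R by lra.
(* One factor for each coordinate move: 2^p from [shift_energyD], and 2 because the two energies
   there are summed. The exponent is [N], written as a list length for the induction on the list of
   coordinates. *)
exists ((2 `^ p * 2) ^+ size (index_enum 'I_N))%R.
  by rewrite exprn_gt0// mulr_gt0// powR_gt0.
move=> u h tu; set G := integral _ _ _.
have G0 : 0 <= G by apply: integral_ge0 => x _; rewrite lee_fin powR_ge0.
have c1 : (1 <= 2 `^ p * 2 :> R)%R.
  by rewrite -[leLHS]mulr1 ler_pM// ?ler1n// -[leLHS](powRr0 2) ler_powR// ler1n.
have Hi i : shift_energy p u (h ord0 i *: e_ i)%R <= (enorm h `^ p)%:E * G.
  apply: le_trans (shift_energy_line i (h ord0 i) p1 tu) _.
  apply: lee_pmul.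
  - by rewrite lee_fin powR_ge0.
  - by apply: integral_ge0 => x _; rewrite lee_fin powR_ge0.
  - by rewrite lee_fin ler_powR_base// coord_le_enorm.
  apply: ge0_le_integral => //.
  - apply: measurable_abs_powR; apply: test_fun_measurable.
    exact: test_fun_partial.
  - by apply: measurable_abs_powR; exact: measurable_gradient_norm.
  move=> x _; rewrite lee_fin ler_powR_base// (ger0_norm (enorm_ge0 _)).
  by have := coord_le_enorm (gradient u x) i; rewrite mxE.
rewrite {1}(rv_sum_delta h) EFinM -muleA.
elim: (index_enum _) => [|i r ih].
  rewrite big_nil mul1e /shift_energy integral0_eq.
    by rewrite mule_ge0// lee_fin powR_ge0.
  by move=> x _; rewrite addr0 subrr normr0 powR0// gt_eqF//; lra.
rewrite big_cons /=; apply: le_trans (shift_energyD _ _ p0 (test_fun_measurable tu)) _.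
rewrite exprS EFinM -muleA EFinM -muleA; apply: lee_wpmul2l.
  by rewrite lee_fin powR_ge0.
set X := (X in _ <= _ * (_ * X)).
have X0 : 0 <= X by rewrite mule_ge0// lee_fin powR_ge0.
rewrite mule_natl mule2n; apply: leeD; last exact: ih.
apply: le_trans (Hi i) _; rewrite -[leLHS]mul1e; apply: lee_wpmul2r => //.
by rewrite lee_fin exprn_ege1.
Qed.

Lemma shift_energy_le_K p : (1 < p)%R -> exists2 C : R, (0 < C)%R &
  forall Omega u h, C0oo Omega u -> shift_energy p u h <=
   C%:E * K_functional p Omega (enorm h) u `^ p.
Proof.
move=> p1; have p0 : (0 <= p)%R by lra.
have pp : (0 < p)%R by lra.
have pN0 : p != 0%R by rewrite gt_eqF.
have [C1 C10 HC1] := shift_energy_gradient p1.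
have t2 : (0 < 2 `^ p :> R)%R by rewrite powR_gt0.
pose C := (2 `^ p * (C1 + 2 `^ p * 2))%R.
have C0 : (0 < C)%R by rewrite mulr_gt0// addr_gt0// mulr_gt0.
exists C => // Omega u h Cu.
have tu := C0oo_test_fun Cu.
have mu_ := test_fun_measurable tu.
(* The infimum defines [K_functional] itself and not its power, so the estimate is moved to the p-th
   root, where it can be checked against each competitor [v]. *)
suff H : (C^-1%:E * shift_energy p u h) `^ p^-1 <= K_functional p Omega (enorm h) u.
  have := lee_poweR_base p0 (poweR_ge0 _ _) H.
  rewrite poweRVK//; last first.
    by rewrite mule_ge0 ?shift_energy_ge0// lee_fin invr_ge0 ltW.
  by rewrite muleC lee_pdivrMr// muleC.
apply/ereal_infP => _ [v Cv <-].
have tv := C0oo_test_fun Cv.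
have mv := test_fun_measurable tv.
set a := Lp_norm _ _ _; set b := (_ * Lp_norm _ _ _).
have a0 : 0 <= a by exact: Lp_norm_ge0.
have b0 : 0 <= b by rewrite mule_ge0 ?Lp_norm_ge0// lee_fin enorm_ge0.
have ab0 : 0 <= a + b by exact: adde_ge0.
apply: (lee_poweR_inv pp) => //; first exact: poweR_ge0.
rewrite poweRVK//; last first.
  by rewrite mule_ge0 ?shift_energy_ge0// lee_fin invr_ge0 ltW.
rewrite muleC lee_pdivrMr//.
have mw : measurable_fun setT (u \- v)%R by exact: measurable_funB.
have Da : shift_energy p (u \- v)%R h <= (2 `^ p * 2)%:E * (a + b) `^ p.
  apply: le_trans (shift_energy_le_Lp h p0 mw) _.
  apply: lee_wpmul2l; first by rewrite lee_fin mulr_ge0// powR_ge0.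
  apply: (@le_trans _ _ (a `^ p)); last first.
    by apply: lee_poweR_base => //; exact: leeDl.
  (* The norm is over [Omega] and the shift energy over the whole space; they match since [u] and
     [v] vanish outside [Omega]. The same holds for the gradient of [v] below. *)
  rewrite /a Lp_norm_poweR// (@integral_vanish_out _ _ Omega); first exact: lexx.
  by move=> x xO; rewrite /= (C0oo_out Cu xO) (C0oo_out Cv xO) subrr normr0 powR0.
have Db : shift_energy p v h <= C1%:E * (a + b) `^ p.
  apply: le_trans (HC1 _ h tv) _; rewrite EFinM -muleA.
  apply: lee_wpmul2l; first by rewrite lee_fin ltW.
  apply: (@le_trans _ _ (b `^ p)); last first.
    by apply: lee_poweR_base => //; exact: leeDr.
  rewrite /b poweRM ?Lp_norm_ge0 ?lee_fin ?enorm_ge0// Lp_norm_poweR//.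
  rewrite (@integral_vanish_out _ _ Omega); first exact: lexx.
  move=> x xO.
  rewrite (_ : gradient v x = 0%R).
    rewrite /enorm big1 ?sqrtr0 ?normr0 ?powR0// => i _.
    by rewrite mxE expr0n.
  apply/rowP => i; rewrite !mxE partial_deriv_out// => xv; apply: xO.
  by case: Cv => _ _; exact.
apply: (@le_trans _ _ ((2 `^ p)%:E *
    (shift_energy p v h + shift_energy p (u \- v)%R h))).
  apply: integral_powRD_le => //.
  - by apply: measurable_funB => //; exact: measurable_shift.
  - by apply: measurable_funB => //; exact: measurable_shift.
  - by apply: measurable_funB => //; exact: measurable_shift.
  move=> x /=; rewrite [X in (`|X| <= _)%R](_ : _ =
    (v (x + h) - v x) + ((u (x + h) - v (x + h)) - (u x - v x)))%R; last ring.
  exact: ler_normD.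
rewrite [leRHS]muleC /C EFinM -muleA; apply: lee_wpmul2l; first by rewrite lee_fin ltW.
rewrite EFinD ge0_muleDl ?lee_fin ?(ltW C10)//.
exact: leeD.
Qed.

End shift_energy.

(** * Averaging the K-functional over dyadic shells *)

Section dyadic_average.
Variables (R : realType) (N : nat).
Local Open Scope ereal_scope.
Local Notation mu := (lebesgue_rv R N).
Implicit Types (Omega : set 'rV[R]_N) (u : 'rV[R]_N -> R) (h : 'rV[R]_N).

Definition X_weight s p Omega u (t : R) : \bar R :=
  (K_functional p Omega t u * ((t `^ s)^-1)%:E) `^ p * (t^-1)%:E.

Lemma X_weight_ge0 s p Omega u (t : R) : (0 < t)%R -> 0 <= X_weight s p Omega u t.
Proof.
by move=> t0; rewrite mule_ge0 ?poweR_ge0// lee_fin invr_ge0 ltW.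
Qed.

Lemma X_weightE s p Omega u (t : R) : (0 < t)%R ->
  X_weight s p Omega u t =
  (((t `^ s) `^ p)^-1 * t^-1)%:E * K_functional p Omega t u `^ p.
Proof.
move=> t0; rewrite /X_weight poweRM ?K_functional_ge0 ?(ltW t0)//; last first.
  by rewrite lee_fin invr_ge0 powR_ge0.
rewrite poweR_EFin -[((t `^ s)^-1)%R]powR_inv1 ?powR_ge0// -powRrM mulN1r powRN.
by rewrite -muleA -EFinM muleC.
Qed.

Lemma measurable_inv_R d (T : measurableType d) (f : T -> R) :
  measurable_fun setT f -> measurable_fun setT (fun x => (f x)^-1)%R.
Proof.
(* The square makes the base nonnegative, so that its [powR] of exponent -1 is the inverse. Where
   [f x = 0] both sides are 0, because [0^-1 = 0]. *)
move=> mf; rewrite (_ : (fun x => _) = fun x => f x * (f x ^+ 2) `^ (-1))%R.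
  apply: measurable_funM => //; apply: (measurableT_comp (measurable_powR _)).
  exact: measurable_funX.
apply/funext => x; rewrite powR_inv1 ?sqr_ge0//.
have [->|x0] := eqVneq (f x) 0%R; first by rewrite invr0 mul0r.
by rewrite expr2; field.
Qed.

Lemma enormN (h : 'rV[R]_N) : enorm (- h)%R = enorm h.
Proof. by rewrite /enorm; congr Num.sqrt; apply: eq_bigr => i _; rewrite mxE sqrrN. Qed.

Lemma measurable_X_weight s p Omega u :
  measurable_fun [set: measurableTypeR R] (X_weight s p Omega u).
Proof.
apply: emeasurable_funM.
  apply: (measurableT_comp (measurable_poweR p)).
  apply: emeasurable_funM; first exact: measurable_K_functional.
  by apply/measurable_EFinP; apply: measurable_inv_R; exact: measurable_powR.
by apply/measurable_EFinP; apply: measurable_inv_R.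
Qed.

Lemma measurable_lt_set d (T : measurableType d) (f g : T -> R) :
  measurable_fun setT f -> measurable_fun setT g ->
  measurable [set x | f x < g x]%R.
Proof.
move=> mf mg; rewrite -[X in measurable X]setTI.
exact: (measurable_fun_ltr mf mg measurableT (Y := [set true])).
Qed.

Lemma measurable_le_set d (T : measurableType d) (f g : T -> R) :
  measurable_fun setT f -> measurable_fun setT g ->
  measurable [set x | f x <= g x]%R.
Proof.
move=> mf mg; rewrite -[X in measurable X]setTI.
exact: (measurable_fun_ler mf mg measurableT (Y := [set true])).
Qed.

Lemma ler_inv_anti (x y : R) : (0 < x -> x <= y -> y^-1 <= x^-1)%R.
Proof. by move=> x0 xy; rewrite lef_pV2// posrE// (lt_le_trans x0). Qed.

Lemma inv_weight_le (n : nat) (s p t r : R) :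
  (0 <= s -> 0 <= p -> 0 < t -> t <= r ->
  (r ^+ n)^-1 * (((r `^ s) `^ p)^-1 * r^-1) <=
  (t ^+ n)^-1 * (((t `^ s) `^ p)^-1 * t^-1))%R.
Proof.
move=> s0 p0 t0 tr; have r0 : (0 < r)%R by exact: lt_le_trans tr.
have tn : (0 < t ^+ n)%R by exact: exprn_gt0.
have rn : (0 < r ^+ n)%R by exact: exprn_gt0.
have tsp : (0 < (t `^ s) `^ p)%R by rewrite !powR_gt0.
have rsp : (0 < (r `^ s) `^ p)%R by rewrite !powR_gt0.
have [tn0 rn0] := (ltW tn, ltW rn); have [ts0 rs0] := (ltW tsp, ltW rsp).
apply: ler_pM.
- by rewrite invr_ge0.
- by rewrite mulr_ge0// invr_ge0// ltW.
- by apply: ler_inv_anti => //; rewrite lerXn2r// nnegrE ltW.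
apply: ler_pM; [by rewrite invr_ge0|by rewrite invr_ge0 ltW| |exact: ler_inv_anti].
apply: (ler_inv_anti tsp); apply: ler_powR_base; [exact: p0|exact: powR_ge0|].
by apply: ler_powR_base; [exact: s0|exact: ltW|exact: tr].
Qed.

(** The scales over which the value of the K-functional at [enorm h] is averaged. Being open on the
    left, it contains positive numbers only and is empty at [h = 0]. *)
Definition shell (h : 'rV[R]_N) : set R := [set` `]enorm h, (2 * enorm h)%R]%R].

Lemma measurable_shell :
  measurable [set z : 'rV[R]_N * measurableTypeR R | shell z.1 z.2].
Proof.
rewrite (_ : [set _ | _] =
  [set z : 'rV[R]_N * measurableTypeR R | enorm z.1 < z.2]%R `&`
  [set z : 'rV[R]_N * measurableTypeR R | z.2 <= 2 * enorm z.1]%R); last first.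
  by apply/seteqP; split => z; rewrite /shell /= in_itv /= => /andP.
have me : measurable_fun setT
    (fun z : 'rV[R]_N * measurableTypeR R => enorm z.1).
  exact: (measurableT_comp (@measurable_enorm R N) measurable_fst).
apply: measurableI; first exact: measurable_lt_set me measurable_snd.
apply: measurable_le_set; first exact: measurable_snd.
exact: measurable_funM.
Qed.

(** On the shell the K-functional is at least its value at [r = enorm h], and the weight, a
    decreasing power of [t], is at least its value [k] at [2 * r]. The constant is what remains of
    [k] times the length [r] of the shell. *)
Lemma K_functional_le_average s p Omega u h : (0 < s)%R -> (1 < p)%R ->
  (0 < enorm h)%R ->
  ((enorm h `^ (N%:R + s * p))^-1)%:E * K_functional p Omega (enorm h) u `^ p <=
  (2 * 2 ^+ N * 2 `^ (s * p))%:E *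
  \int[lebesgue_measure]_(t in `]0%R, +oo[)
     ((\1_(shell h) t)%:E * ((t ^+ N)^-1%:E * X_weight s p Omega u t)).
Proof.
move=> s0 p1; set r := enorm h => r0.
have p0 : (0 <= p)%R by lra.
have r20 : (0 < 2 * r)%R by lra.
pose k : R := (((2 * r) ^+ N)^-1 * ((((2 * r) `^ s) `^ p)^-1 * (2 * r)^-1))%R.
have k0 : (0 <= k)%R.
  by rewrite !mulr_ge0// invr_ge0 ?powR_ge0 ?exprn_ge0// ltW.
pose Kr := K_functional p Omega r u `^ p.
have E : ((r `^ (N%:R + s * p))^-1)%:E * Kr =
    (2 * 2 ^+ N * 2 `^ (s * p))%:E * ((k * r)%:E * Kr).
  rewrite muleA -EFinM; congr ((_%:E) * _).
  have rN : (r ^+ N != 0)%R by rewrite expf_neq0// gt_eqF.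
  have rs : (r `^ (s * p) != 0)%R by rewrite gt_eqF// powR_gt0.
  have ts : (2 `^ (s * p) != 0 :> R)%R by rewrite gt_eqF// powR_gt0.
  have tN : (2 ^+ N != 0 :> R)%R by rewrite expf_neq0.
  have rn : r != 0%R by rewrite gt_eqF.
  rewrite powRD; last by rewrite rn implybT.
  rewrite powR_mulrn ?(ltW r0)// /k -powRrM powRM ?(ltW r0)// exprMn.
  by field; rewrite rN rs ts tN rn.
rewrite -/Kr E; apply: lee_wpmul2l; first by rewrite lee_fin !mulr_ge0// powR_ge0.
have mS : measurable (shell h) by exact: measurable_itv.
have tpos t : shell h t -> (0 < t)%R.
  by rewrite /shell /= in_itv /= => /andP[rt _]; exact: lt_trans rt.
have -> : (k * r)%:E * Kr = \int[lebesgue_measure]_(t in shell h) (k%:E * Kr).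
  rewrite integral_cst// [X in _ = _ * X](_ : _ = r%:E).
    by rewrite EFinM -!muleA; congr (_ * _); rewrite muleC.
  transitivity ((@lebesgue_measure R) [set` `]r, (2 * r)%R]%R]) => //.
  rewrite lebesgue_measure_itv /= lte_fin ifT; last lra.
  by rewrite -EFinB; congr EFin; lra.
rewrite [leRHS](_ : _ = \int[lebesgue_measure]_(t in shell h)
    ((t ^+ N)^-1%:E * X_weight s p Omega u t)); last first.
  rewrite [LHS]integral_mkcond [RHS]integral_mkcond; apply: eq_integral => t _.
  rewrite !patchE indicE; case: (boolP (t \in shell h)) => ts; last first.
    by case: ifPn => // _; rewrite mul0e.
  rewrite mem_set ?mul1e//= in_itv /= andbT; exact: (tpos _ (set_mem ts)).
have Kr0 : 0 <= Kr by exact: poweR_ge0.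
apply: ge0_le_integral => //.
- by move=> t _; rewrite mule_ge0// lee_fin.
- apply: (@measurable_funTS _ _ (measurableTypeR R)).
  apply: emeasurable_funM; last exact: measurable_X_weight.
  by apply/measurable_EFinP; apply: measurable_inv_R; exact: measurable_funX.
move=> t ht; have t0 := tpos _ ht.
move: ht; rewrite /shell /= in_itv /= => /andP[rt tr].
rewrite X_weightE// muleA -EFinM; apply: lee_pmul => //; last first.
  apply: lee_poweR_base => //; first exact/K_functional_ge0/ltW.
  exact/K_functional_mono/ltW.
have tN : (0 < t ^+ N)%R by exact: exprn_gt0.
have tsp : (0 < (t `^ s) `^ p)%R by rewrite !powR_gt0.
by rewrite lee_fin; apply: inv_weight_le => //; exact: ltW.
Qed.

(** The constant depends on [s] through 2^(s p), which the equivalence of norms allows, as [s] is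
    fixed there. *)
Lemma Dsp_le_Xsp s p : (0 < s)%R -> (1 < p)%R -> exists2 c : R, (0 < c)%R &
  forall Omega u, C0oo Omega u ->
    Dsp_norm s p u `^ p <= c%:E * Xsp_norm s p Omega u `^ p.
Proof.
move=> s0 p1; have p0 : (0 <= p)%R by lra.
have [C1 C10 HC1] := @shift_energy_le_K R N p p1.
pose c2 : R := (2 * 2 ^+ N * 2 `^ (s * p))%R.
have c20 : (0 < c2)%R by rewrite !mulr_gt0// ?exprn_gt0// powR_gt0.
have c12 : (0 < C1 * c2)%R by exact: mulr_gt0.
exists (C1 * c2 * 2 ^+ N)%R; first by rewrite mulr_gt0// exprn_gt0.
move=> Omega u Cu; have tu := C0oo_test_fun Cu.
have mu_ := test_fun_measurable tu.
pose al : R := (N%:R + s * p)%R.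
have al0 : (0 < al)%R by rewrite ltr_wpDl// mulr_gt0//; lra.
rewrite Dsp_norm_poweR; last lra.
pose F (z : 'rV[R]_N * 'rV[R]_N) : \bar R :=
  (`|u z.1 - u z.2| `^ p / enorm (z.1 - z.2) `^ al)%:E.
pose G (x h : 'rV[R]_N) : \bar R :=
  (`|u (x + h)%R - u x| `^ p)%:E * ((enorm h `^ al)^-1)%:E.
have m1 : measurable_fun setT (fun z : 'rV[R]_N * 'rV[R]_N => u z.1).
  exact: (measurableT_comp mu_ measurable_fst).
have m2 : measurable_fun setT (fun z : 'rV[R]_N * 'rV[R]_N => u z.2).
  exact: (measurableT_comp mu_ measurable_snd).
have menorm (f : 'rV[R]_N * 'rV[R]_N -> 'rV[R]_N) : measurable_fun setT f ->
    measurable_fun setT (fun z => (enorm (f z) `^ al)^-1)%R.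
  move=> mf; apply: measurable_inv_R; apply: (measurableT_comp (measurable_powR _)).
  exact: (measurableT_comp (@measurable_enorm R N) mf).
have mF : measurable_fun setT F.
  apply/measurable_EFinP; apply: measurable_funM.
    by apply/measurable_EFinP; apply: measurable_abs_powR; exact: measurable_funB.
  by apply: menorm; apply: measurable_fun_rvB; [exact: measurable_fst|exact: measurable_snd].
have F0 z : 0 <= F z by rewrite lee_fin divr_ge0// powR_ge0.
have mG : measurable_fun setT (fun z : 'rV[R]_N * 'rV[R]_N => G z.1 z.2).
  apply: emeasurable_funM.
    apply: measurable_abs_powR; apply: measurable_funB => //.
    apply: (measurableT_comp mu_).
    by apply: measurable_fun_rvD; [exact: measurable_fst|exact: measurable_snd].
  by apply/measurable_EFinP; apply: menorm; exact: measurable_snd.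
have G0 x h : 0 <= G x h by rewrite mule_ge0// lee_fin ?powR_ge0// invr_ge0 powR_ge0.
rewrite (@fubini_tonelli1 _ _ _ _ _ mu mu F mF F0).
(* The substitution [y = h + x] makes the kernel a function of [h] alone, so that integrating in [x]
   first yields the shift energy. *)
have -> : \int[mu]_x fubini_F mu F x = \int[mu]_x \int[mu]_h G x h.
  apply: eq_integral => x _; rewrite /fubini_F.
  rewrite -(integral_rvD x (f := fun y => F (x, y))); last first.
    exact: (measurableT_comp mF (measurable_pair1 x)).
  apply: eq_integral => h _; rewrite /F /G /= -EFinM distrC [(h + x)%R]addrC.
  by rewrite opprD addrA subrr add0r enormN.
rewrite (fubini_tonelli (fun z => G z.1 z.2))//=.
pose W (h : 'rV[R]_N) (t : R) : \bar R :=
  (\1_(shell h) t)%:E * ((t ^+ N)^-1%:E * X_weight s p Omega u t).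
have Wm : measurable_fun setT (fun z : 'rV[R]_N * measurableTypeR R => W z.1 z.2).
  apply: emeasurable_funM.
    apply/measurable_EFinP.
    rewrite (_ : (fun _ => _) = \1_[set z : 'rV[R]_N * measurableTypeR R | shell z.1 z.2]).
      by apply: measurable_indic; exact: measurable_shell.
    by apply/funext => z; rewrite !indicE; congr (_%:R); apply/idP/idP => /set_mem H; exact/mem_set.
  apply: emeasurable_funM.
    apply/measurable_EFinP; apply: measurable_inv_R; apply: measurable_funX.
    exact: measurable_snd.
  exact: (measurableT_comp (measurable_X_weight s p Omega u) measurable_snd).
have mI : measurable ([set` `]0%R, +oo[%R] : set R) by exact: measurable_itv.
have W0 h t : 0 <= W h t.
  rewrite /W indicE; case: (boolP (t \in shell h)) => [/set_mem|_]; last first.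
    by rewrite mul0e.
  rewrite /shell /= in_itv /= => /andP[ht _].
  have t0 : (0 < t)%R by exact: le_lt_trans (enorm_ge0 _) ht.
  by rewrite mul1e mule_ge0 ?X_weight_ge0// lee_fin invr_ge0 exprn_ge0// ltW.
have mIW : measurable_fun setT
    (fun h => \int[lebesgue_measure]_(t in `]0%R, +oo[) W h t).
  exact: measurable_integral_in.
apply: (@le_trans _ _ ((C1 * c2)%:E *
    \int[mu]_h \int[lebesgue_measure]_(t in `]0%R, +oo[) W h t)).
  rewrite -ge0_integralZl_EFin//; last 2 first.
  - by move=> h _; apply: integral_ge0 => t _; exact: W0.
  - exact: ltW.
  apply: ge0_le_integral => //.
  - by move=> h _; apply: integral_ge0.
  - apply: (@measurable_fun_fubini_tonelli_G _ _ _ _ _ mu (fun z => G z.1 z.2)) => //.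
  - exact: measurable_funeM.
  move=> h _.
  rewrite [leLHS](_ : _ = shift_energy p u h * ((enorm h `^ al)^-1)%:E); last first.
    rewrite /G ge0_integralZr//.
    - by apply: measurable_abs_powR; apply: measurable_funB => //; exact: measurable_shift.
    - by rewrite lee_fin invr_ge0 powR_ge0.
  (* At [enorm h = 0] the kernel takes the default value [0^-1 = 0] and the left side vanishes; the
     average over the shell requires [0 < enorm h]. *)
  have [h0|h0] := eqVneq (enorm h) 0%R.
    rewrite h0 powR0 ?gt_eqF// invr0 mule0 mule_ge0//.
      by rewrite lee_fin ltW.
    by apply: integral_ge0 => t _; exact: W0.
  have {}h0 : (0 < enorm h)%R by rewrite lt_def h0 enorm_ge0.
  apply: (@le_trans _ _ (C1%:E * (((enorm h `^ al)^-1)%:E *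
      K_functional p Omega (enorm h) u `^ p))).
    rewrite muleCA muleC; apply: lee_wpmul2l.
      by rewrite lee_fin invr_ge0 powR_ge0.
    exact: HC1.
  rewrite EFinM -muleA; apply: lee_wpmul2l; first by rewrite lee_fin ltW.
  exact: K_functional_le_average.
rewrite [leRHS](_ : _ = (C1 * c2)%:E *
  ((2 ^+ N)%:E * Xsp_norm s p Omega u `^ p)); last by rewrite muleA -EFinM.
apply: lee_wpmul2l; first by rewrite lee_fin ltW.
rewrite tonelli_in// Xsp_norm_poweR; last lra.
rewrite -ge0_integralZl_EFin//; last 2 first.
- by move=> t /=; rewrite in_itv /= andbT => t0; exact: X_weight_ge0.
- exact: (measurable_funTS (measurable_X_weight s p Omega u)).
apply: ge0_le_integral => //.
- by move=> t t0; apply: integral_ge0 => h _; exact: W0.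
- apply: (@measurable_funTS _ _ (measurableTypeR R)).
  by apply: (@measurable_fun_fubini_tonelli_G _ _ _ _ _ mu (fun z => W z.1 z.2)).
- apply: measurable_funeM.
  exact: (measurable_funTS (measurable_X_weight s p Omega u)).
move=> t /=; rewrite in_itv /= andbT => t0.
pose Y := ((t ^+ N)^-1)%:E * X_weight s p Omega u t.
have tN0 : (0 < t ^+ N)%R by exact: exprn_gt0.
have Y0 : 0 <= Y by rewrite mule_ge0 ?X_weight_ge0// lee_fin invr_ge0 ltW.
(* If [t] is in the shell of [h] then [h] lies in this cube, whose measure [(2 * t) ^+ N] cancels
   the factor [(t ^+ N)^-1]. *)
pose Q : set 'rV[R]_N := [set h | `|h| <= t]%R.
have mQ : measurable Q.
  by apply: measurable_le_set => //; exact: measurable_normr_rv.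
have mQ1 : measurable_fun setT (fun h => (\1_Q h)%:E : \bar R).
  by apply/measurable_EFinP; exact: measurable_indic.
apply: (@le_trans _ _ (\int[mu]_h (Y * (\1_Q h)%:E))).
  apply: ge0_le_integral => //.
  - exact: (measurableT_comp Wm (measurable_pair2 t)).
  - exact: measurable_funeM.
  move=> h _; rewrite /W -/Y muleC; apply: lee_wpmul2l => //.
  rewrite lee_fin !indicE ler_nat; case: (boolP (t \in shell h)) => // /set_mem.
  rewrite /shell /= in_itv /= => /andP[ht _].
  by rewrite mem_set// /Q /= (le_trans (normr_le_enorm h))// ltW.
rewrite ge0_integralZl// integral_indic// setIT.
rewrite [X in Y * X](_ : _ = ((2 * t) ^+ N)%:E); last exact: lebesgue_rv_cube (ltW t0).
rewrite /Y muleAC -EFinM exprMn.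
by rewrite [X in X%:E * _](_ : _ = 2 ^+ N)%R//; field; rewrite gt_eqF.
Qed.

End dyadic_average.

(** * Convolution with a Lipschitz kernel *)

Section kernels.
Variables (R : realType) (N : nat).
Local Notation mu := (lebesgue_rv R N).
Implicit Types (f g rho u : 'rV[R]_N -> R) (x y h b : 'rV[R]_N) (a B : R).
Local Notation e_ i := (delta_mx ord0 i : 'rV[R]_N).

Definition cube_ind a y : R := (`|y| <= a)%R%:R.

Lemma cube_ind_ge0 a y : 0 <= cube_ind a y.
Proof. by rewrite /cube_ind ler0n. Qed.

Lemma measurable_cube a : measurable [set y : 'rV[R]_N | `|y| <= a].
Proof. by apply: measurable_le_set => //; exact: measurable_normr_rv. Qed.

Lemma cube_indE a : cube_ind a = \1_[set y : 'rV[R]_N | `|y| <= a].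
Proof.
apply/funext => y; rewrite indicE /cube_ind.
by case: (boolP (`|y| <= a)) => H; [rewrite mem_set|rewrite memNset//; exact/negP].
Qed.

Lemma measurable_cube_ind a : measurable_fun setT (cube_ind a).
Proof. by rewrite cube_indE; apply: measurable_indic; exact: measurable_cube. Qed.

Lemma integral_cube_ind a : 0 <= a ->
  (\int[mu]_y (cube_ind a y)%:E = ((2 * a) ^+ N)%:E)%E.
Proof.
move=> a0; rewrite cube_indE integral_indic//; last exact: measurable_cube.
by rewrite setIT; exact: lebesgue_rv_cube.
Qed.

Lemma integral_abs_cube_le f a B : 0 <= a -> 0 <= B -> measurable_fun setT f ->
  (forall y, `|f y| <= B * cube_ind a y) ->
  (\int[mu]_y `|f y|%:E <= (B * (2 * a) ^+ N)%:E)%E.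
Proof.
move=> a0 B0 mf fB.
rewrite EFinM -integral_cube_ind// -ge0_integralZl_EFin//; last 2 first.
- by move=> y _; rewrite lee_fin cube_ind_ge0.
- by apply/measurable_EFinP; exact: measurable_cube_ind.
apply: ge0_le_integral => //.
- by apply/measurable_EFinP; exact: measurableT_comp.
- apply/measurable_EFinP; apply: measurable_funM => //.
  exact: measurable_cube_ind.
by move=> y _; rewrite -EFinM lee_fin.
Qed.

Lemma integrable_cube f a B : 0 <= a -> 0 <= B -> measurable_fun setT f ->
  (forall y, `|f y| <= B * cube_ind a y) -> mu.-integrable setT (EFin \o f).
Proof.
move=> a0 B0 mf fB; apply/integrableP; split; first exact/measurable_EFinP.
by rewrite (le_lt_trans (integral_abs_cube_le a0 B0 mf fB))// ltry.
Qed.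

Lemma Rintegral_cube_le f a B : 0 <= a -> 0 <= B -> measurable_fun setT f ->
  (forall y, `|f y| <= B * cube_ind a y) ->
  `|\int[mu]_y f y| <= B * (2 * a) ^+ N.
Proof.
move=> a0 B0 mf fB.
apply: le_trans (le_normr_Rintegral _ (integrable_cube a0 B0 mf fB)) _ => //.
have H := integral_abs_cube_le a0 B0 mf fB.
rewrite /Rintegral -[leRHS]/(fine (B * (2 * a) ^+ N)%:E).
apply: fine_le => //; rewrite ge0_fin_numE ?(le_lt_trans H) ?ltry//.
by apply: integral_ge0 => y _; rewrite lee_fin.
Qed.

(** Bounded and zero off a cube: this makes the integral against every bounded function converge. It
    holds for [bump], for [cube_ind], for multiples of kernels, and for differences of translated
    bumps. *)
Definition kernel_fun rho := measurable_fun setT rho /\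
  exists a B, [/\ 0 <= a, 0 <= B & forall y, `|rho y| <= B * cube_ind a y].

Lemma kernel_funZ (c : R) rho : kernel_fun rho -> kernel_fun (fun y => c * rho y).
Proof.
move=> [mr [a [B [a0 B0 rB]]]]; split; first exact: measurable_funM.
exists a, (`|c| * B); split => //; first exact: mulr_ge0.
by move=> y; rewrite normrM -mulrA ler_wpM2l.
Qed.

Variables (k : R) (b : 'rV[R]_N).

(** All dependence on [x] sits in the argument of [u]: derivatives fall on [u], and the kernel is
    merely multiplied by [k]. *)
Definition conv rho u x : R := \int[mu]_y (rho y * u (k *: (x + y) + b)).

Lemma measurable_conv_arg u x : measurable_fun setT u ->
  measurable_fun setT (fun y => u (k *: (x + y) + b)).
Proof.
move=> mu_; apply: (measurableT_comp mu_); apply: measurable_fun_rvD => //.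
by apply: measurable_fun_rvZ; exact: measurable_fun_rvD.
Qed.

Lemma integrable_kernelM rho g (G : R) : kernel_fun rho -> measurable_fun setT g ->
  (forall y, `|g y| <= G) -> mu.-integrable setT (EFin \o (fun y => rho y * g y)).
Proof.
move=> [mr [a [B [a0 B0 rB]]]] mg gG.
have G0 : 0 <= G by exact: le_trans (normr_ge0 _) (gG 0).
apply: (@integrable_cube _ a (B * G)) => //; first exact: mulr_ge0.
  exact: measurable_funM.
by move=> y; rewrite normrM mulrAC; apply: ler_pM.
Qed.

Lemma Rintegral_kernelM_le rho : kernel_fun rho -> exists2 C : R, 0 <= C &
  forall g (G : R), measurable_fun setT g -> (forall y, `|g y| <= G) ->
    `|\int[mu]_y (rho y * g y)| <= C * G.
Proof.
move=> [mr [a [B [a0 B0 rB]]]]; exists (B * (2 * a) ^+ N).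
  by rewrite mulr_ge0// exprn_ge0// mulr_ge0.
move=> g G mg gG; have G0 : 0 <= G by exact: le_trans (normr_ge0 _) (gG 0).
rewrite mulrAC; apply: Rintegral_cube_le => //; first exact: mulr_ge0.
  exact: measurable_funM.
by move=> y; rewrite normrM mulrAC; apply: ler_pM.
Qed.

Definition bounded_fun g := measurable_fun setT g /\ exists G : R, forall y, `|g y| <= G.

Lemma bounded_funB f g : bounded_fun f -> bounded_fun g ->
  bounded_fun (fun y => f y - g y).
Proof.
move=> [mf [F fF]] [mg [G gG]]; split; first exact: measurable_funB.
by exists (F + G) => y; apply: (le_trans (ler_normB _ _)); exact: lerD.
Qed.

Lemma bounded_funZ (c : R) f : bounded_fun f -> bounded_fun (fun y => c * f y).
Proof.
move=> [mf [F fF]]; split; first exact: measurable_funM.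
by exists (`|c| * F) => y; rewrite normrM ler_wpM2l.
Qed.

Lemma bounded_conv_arg u x : test_fun u -> bounded_fun (fun y => u (k *: (x + y) + b)).
Proof.
move=> tu; split; first by apply: measurable_conv_arg; exact: test_fun_measurable.
by have [G _ uG] := test_fun_bounded tu; exists G.
Qed.

Lemma Rintegral_kernelB rho f g : kernel_fun rho -> bounded_fun f -> bounded_fun g ->
  \int[mu]_y (rho y * f y) - \int[mu]_y (rho y * g y) =
  \int[mu]_y (rho y * (f y - g y)).
Proof.
move=> kr [mf [F fF]] [mg [G gG]].
have i1 := integrable_kernelM kr mf fF; have i2 := integrable_kernelM kr mg gG.
by rewrite -RintegralB//; apply: eq_Rintegral => y _; rewrite mulrBr.
Qed.

Lemma Rintegral_kernelZ rho (c : R) f : kernel_fun rho -> bounded_fun f ->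
  c * \int[mu]_y (rho y * f y) = \int[mu]_y (rho y * (c * f y)).
Proof.
move=> kr [mf [F fF]]; have i1 := integrable_kernelM kr mf fF.
by rewrite -RintegralZl//; apply: eq_Rintegral => y _; rewrite mulrCA.
Qed.

Lemma conv_lipschitz rho u : kernel_fun rho -> test_fun u -> exists2 L : R, 0 <= L &
  forall x h, `|conv rho u (x + h) - conv rho u x| <= L * `|h|.
Proof.
move=> kr tu; have [L L0 uL] := test_fun_lipschitz tu.
have [C C0 HC] := Rintegral_kernelM_le kr.
have mu_ := test_fun_measurable tu.
exists (C * (L * `|k|)); first by rewrite !mulr_ge0.
move=> x h; rewrite /conv Rintegral_kernelB//; [|exact: bounded_conv_arg..].
rewrite -!mulrA; apply: HC.
  by apply: measurable_funB; exact: measurable_conv_arg.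
move=> y; rewrite -normrZ.
rewrite (_ : k *: (x + h + y) + b = (k *: (x + y) + b) + k *: h); first exact: uL.
by rewrite -addrA [h + y]addrC addrA scalerDr addrAC.
Qed.

Lemma lipschitz_continuous_rv f (L : R) : 0 <= L ->
  (forall x h, `|f (x + h) - f x| <= L * `|h|) -> continuous f.
Proof.
move=> L0 fL x; apply/(@cvgrPdist_le _ _ _ (nbhs x) _ f (f x)) => /= e e0.
have L1 : 0 < L + 1 by rewrite ltr_wpDl.
have eL : 0 < e / (L + 1) by exact: divr_gt0.
apply/nbhs_ballP; exists (e / (L + 1)) => //= y /rv_ballP xy.
have := fL x (y - x); rewrite (addrC x) subrK distrC => /le_trans; apply.
apply: (@le_trans _ _ ((L + 1) * (e / (L + 1)))).
  by apply: ler_pM => //; [rewrite lerDl|rewrite distrC ltW].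
by rewrite mulrC divfK// gt_eqF.
Qed.

(** The mean value point is within [|t|] of [x] and the partial derivative is Lipschitz. Uniformity
    in [x] is the point: it lets one differentiate under the integral without dominated
    convergence. *)
Lemma taylor1_line u i : test_fun u -> exists2 L : R, 0 <= L &
  forall x (t : R), `|u (x + t *: e_ i) - u x - t * partial_deriv i u x| <= L * t ^+ 2.
Proof.
move=> tu; have [L L0 uL] := test_fun_lipschitz (test_fun_partial i tu).
exists L => // x t; have [c ct ->] := mean_value_line i x t tu.
rewrite -mulrBr normrM -[t ^+ 2]real_normK ?num_real// expr2 mulrCA.
apply: ler_wpM2l => //; apply: le_trans (uL _ _) _; apply: ler_wpM2l => //.
rewrite normrZ; apply: (@le_trans _ _ (`|t| * 1)); last by rewrite mulr1.
by apply: ler_pM => //; exact: normr_delta_le.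
Qed.

Lemma conv_derive rho u i x : kernel_fun rho -> test_fun u ->
  is_derive x (e_ i) (conv rho u) (conv (fun y => k * rho y) (partial_deriv i u) x).
Proof.
move=> kr tu; have [L L0 uL] := taylor1_line i tu.
have mu_ := test_fun_measurable tu.
have tp := test_fun_partial i tu; have mp := test_fun_measurable tp.
have [C C0 HC] := Rintegral_kernelM_le kr.
have kkr : kernel_fun (fun y => k * rho y) by exact: kernel_funZ.
set d := conv _ _ x.
(* The Taylor remainder for the displacement [k * h] is quadratic; divided by [h] and integrated
   against the kernel, it leaves an error linear in [|h|]. *)
have key (h : R) : h != 0 ->
    `|h^-1 * (conv rho u (h *: e_ i + x) - conv rho u x) - d| <= C * (L * k ^+ 2) * `|h|.
  move=> h0.
  have -> : h^-1 * (conv rho u (h *: e_ i + x) - conv rho u x) - d =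
      \int[mu]_y (rho y * (h^-1 * (u ((k *: (x + y) + b) + (k * h) *: e_ i)
        - u (k *: (x + y) + b) - (k * h) * partial_deriv i u (k *: (x + y) + b)))).
    have bu z : bounded_fun (fun y => u (k *: (z + y) + b)) by exact: bounded_conv_arg.
    have bp : bounded_fun (fun y => partial_deriv i u (k *: (x + y) + b)).
      exact: bounded_conv_arg.
    rewrite /d /conv.
    rewrite (_ : (fun y => k * rho y * _) =
        fun y => rho y * (k * partial_deriv i u (k *: (x + y) + b))); last first.
      by apply/funext => y; rewrite mulrA [k * rho y]mulrC.
    rewrite Rintegral_kernelB// Rintegral_kernelZ//; last exact: bounded_funB.
    rewrite Rintegral_kernelB//; [|exact/bounded_funZ/bounded_funB|exact: bounded_funZ].
    apply: eq_Rintegral => y _; congr (rho y * _).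
    rewrite (_ : k *: (h *: e_ i + x + y) + b = (k *: (x + y) + b) + (k * h) *: e_ i).
      by field.
    by apply/rowP => j; rewrite !mxE; ring.
  rewrite -[leRHS]mulrA; apply: HC.
    apply: measurable_funM => //; apply: measurable_funB.
      apply: measurable_funB; last exact: measurable_conv_arg.
      exact: (measurable_conv_arg x (measurable_shift ((k * h) *: e_ i) mu_)).
    by apply: measurable_funM => //; exact: measurable_conv_arg.
  move=> y; rewrite normrM normfV.
  apply: (@le_trans _ _ (`|h|^-1 * (L * (k * h) ^+ 2))).
    by apply: ler_wpM2l => //; rewrite invr_ge0.
  rewrite exprMn -[h ^+ 2]real_normK ?num_real//.
  rewrite mulrCA -mulrA; apply: ler_wpM2l => //.
  by rewrite mulrCA expr2 mulKf// normr_eq0.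
have cv : (fun h : R => h^-1 *: ((conv rho u \o shift x) (h *: e_ i) - conv rho u x))
    @ (0:R)^' --> d.
  apply/cvgrPdist_le => /= e e0.
  pose Q := C * (L * k ^+ 2).
  have Q0 : 0 <= Q := mulr_ge0 C0 (mulr_ge0 L0 (sqr_ge0 k)).
  have Q1 : 0 < Q + 1 by rewrite ltr_wpDl.
  have eQ : 0 < e / (Q + 1) by exact: divr_gt0.
  near=> h.
  have h0 : h != 0 by near: h; exact: nbhs_dnbhs_neq.
  rewrite distrC; apply: le_trans (key h h0) _.
  apply: (@le_trans _ _ ((Q + 1) * (e / (Q + 1)))).
    apply: ler_pM => //; first by rewrite lerDl.
    by near: h; exact: dnbhs0_le.
  by rewrite mulrC divfK// gt_eqF.
split; first by apply/cvg_ex; exists d.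
by apply/cvg_lim.
Unshelve. all: end_near. Qed.

(** A partial derivative of [conv] is again a [conv], with another kernel and another test function;
    hence the induction over all of them at once. *)
Lemma conv_smooth rho u : kernel_fun rho -> test_fun u -> smooth (conv rho u).
Proof.
move=> kr tu n; elim: n rho u kr tu => [|n ih] rho u kr tu.
  by have [L L0] := conv_lipschitz kr tu; exact: lipschitz_continuous_rv.
split.
- by have [L L0] := conv_lipschitz kr tu; exact: lipschitz_continuous_rv.
- by move=> i x; case: (conv_derive i x kr tu).
move=> i; rewrite (_ : partial_deriv i _ =
    conv (fun y => k * rho y) (partial_deriv i u)).
  by apply: ih; [exact: kernel_funZ|exact: test_fun_partial].
by apply/funext => x; rewrite /partial_deriv; case: (conv_derive i x kr tu).
Qed.

Lemma conv_neq0 rho u x : conv rho u x != 0 ->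
  exists2 y, rho y != 0 & u (k *: (x + y) + b) != 0.
Proof.
move=> c0; apply: contrapT => H; move/eqP: c0; apply.
rewrite /conv /Rintegral integral0_eq// => y _; congr EFin.
have [->|ry] := eqVneq (rho y) 0; first by rewrite mul0r.
have [->|uy] := eqVneq (u (k *: (x + y) + b)) 0; first by rewrite mulr0.
by exfalso; apply: H; exists y.
Qed.

End kernels.

(** * Inradius and convexity *)

Section inradius.
Variables (R : realType) (N : nat).
Implicit Types (Omega : set 'rV[R]_N) (x y z : 'rV[R]_N).

Lemma enormZ (a : R) x : enorm (a *: x) = `|a| * enorm x.
Proof.
rewrite /enorm -sqrtr_sqr -sqrtrM ?sqr_ge0// mulr_sumr; congr Num.sqrt.
by apply: eq_bigr => i _; rewrite mxE exprMn.
Qed.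

Lemma enorm_le_normr x : enorm x <= N%:R * `|x|.
Proof.
case: N x => [|n] x.
  by rewrite /enorm big_ord0 sqrtr0 mul0r.
have xx : 0 <= n.+1%:R * `|x| by rewrite mulr_ge0.
rewrite -(ger0_norm xx) -sqrtr_sqr /enorm ler_sqrt ?sqr_ge0//.
apply: (@le_trans _ _ (\sum_(i < n.+1) `|x| ^+ 2)).
  apply: ler_sum => i _; rewrite -real_normK ?num_real// lerXn2r ?nnegrE//.
  exact: ler_coord_norm.
rewrite sumr_const card_ord -[leLHS]mulr_natl exprMn.
apply: ler_wpM2r; first exact: sqr_ge0.
by rewrite expr2 ler_peMl// ler1n.
Qed.

Lemma lt_sup_ex (S : set R) c : has_sup S -> c < sup S -> exists2 e, S e & c < e.
Proof.
move=> supS cS; have d0 : 0 < sup S - c by rewrite subr_gt0.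
by have [e Se] := sup_adherent d0 supS; rewrite subKr => ce; exists e.
Qed.

Lemma convex_segment Omega x y (a : R) : convex_set Omega ->
  Omega x -> Omega y -> 0 <= a <= 1 -> Omega (a *: x + (1 - a) *: y).
Proof.
move=> cO Ox Oy a01.
have /= := cO x y (Itv01 (proj1 (andP a01)) (proj2 (andP a01))) (mem_set Ox) (mem_set Oy).
by move=> /set_mem.
Qed.

(* The last point of the segment [x, y] reachable from [x] inside [Omega] is a
   boundary point. *)
Lemma boundary_segment Omega x y : open Omega -> Omega x -> ~ Omega y ->
  exists2 a : R, 0 <= a <= 1 & boundary Omega (x + a *: (y - x)).
Proof.
move=> oO Ox Oy.
pose S := [set a : R | 0 <= a <= 1 /\ forall c, 0 <= c <= a -> Omega (x + c *: (y - x))].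
have S0 : S 0.
  split; first by rewrite lexx ler01.
  by move=> c /andP[c0 c1]; rewrite (_ : c = 0) ?scale0r ?addr0//; apply/eqP; rewrite eq_le c0 c1.
have supS : has_sup S.
  by split; [exists 0|exists 1 => a [/andP[]]].
pose a := sup S.
have a0 : 0 <= a by exact: sup_upper_bound.
have a1 : a <= 1 by apply: ge_sup; [exists 0|move=> c [/andP[]]].
have below c : 0 <= c -> c < a -> Omega (x + c *: (y - x)).
  move=> c0 ca; have [e [_ Se] ce] := lt_sup_ex supS ca.
  by apply: Se; rewrite c0 ltW.
(* If this point were in [Omega], a ball around it would carry the segment on up to [a + eta],
   against the choice of [a]; [a = 1] is excluded because it gives [y]. *)
have Na : ~ Omega (x + a *: (y - x)).
  move=> Oa; have {}a1 : a < 1.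
    rewrite lt_neqAle a1 andbT; apply: contra_notN Oy => /eqP a1'.
    by move: Oa; rewrite a1' scale1r addrC subrK.
  have /nbhs_ballP[e /= e0 qe] : nbhs (x + a *: (y - x)) Omega.
    exact: open_nbhs_nbhs.
  pose eta := Num.min (1 - a) (e / (2 * (`|y - x| + 1))).
  have d1 : 0 < 2 * (`|y - x| + 1) by rewrite mulr_gt0// ltr_wpDl.
  have eta0 : 0 < eta by rewrite lt_min subr_gt0 a1 divr_gt0.
  suff : a + eta <= a by rewrite gerDl leNgt eta0.
  apply: sup_upper_bound => //; split.
    rewrite addr_ge0 ?(ltW eta0)//= -lerBrDl.
    by rewrite ge_min lexx.
  move=> c /andP[c0 ca]; have [|ac] := ltP c a; first exact: below.
  apply: qe; apply/rv_ballP; rewrite opprD addrACA subrr add0r -scalerBl normrZ.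
  rewrite distrC ger0_norm ?subr_ge0//.
  have ce : c - a <= e / (2 * (`|y - x| + 1)).
    rewrite lerBlDl; apply: le_trans ca _.
    by rewrite lerD2l ge_min lexx orbT.
  apply: (@le_lt_trans _ _ (e / (2 * (`|y - x| + 1)) * (`|y - x| + 1))).
    by apply: ler_pM => //; [rewrite subr_ge0|rewrite lerDl].
  rewrite [ltLHS](_ : _ = e / 2); first lra.
  by field; rewrite gt_eqF// ltr_wpDl.
have {}a0 : 0 < a.
  rewrite lt_neqAle a0 andbT; apply: contra_notN Na => /eqP <-.
  by rewrite scale0r addr0.
exists a; first by rewrite ltW.
split; last by move=> /interior_subset.
move=> B /nbhs_ballP[e /= e0 qe].
have d1 : 0 < `|y - x| + 1 by rewrite ltr_wpDl.
pose c := Num.max 0 (a - e / (`|y - x| + 1)).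
have ca : c < a by rewrite gt_max a0 gtrDl oppr_lt0 divr_gt0.
have c0 : 0 <= c by rewrite le_max lexx.
exists (x + c *: (y - x)); split; first exact: below.
apply: qe; apply/rv_ballP; rewrite opprD addrACA subrr add0r -scalerBl normrZ.
rewrite ger0_norm ?subr_ge0 ?(ltW ca)//.
have ace : a - c <= e / (`|y - x| + 1) by rewrite lerBlDl -lerBlDr le_max lexx orbT.
have [->|yx] := eqVneq `|y - x| 0; first by rewrite mulr0.
apply: (@le_lt_trans _ _ (e / (`|y - x| + 1) * `|y - x|)).
  by apply: ler_wpM2r.
rewrite mulrAC ltr_pdivrMr// ltr_pM2l//; first by rewrite ltrDl.
Qed.

Lemma edist_set_le x y (A : set 'rV[R]_N) : A y -> edist_set x A <= enorm (x - y).
Proof.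
move=> Ay; apply: ge_inf; last by exists y.
by exists 0 => _ [z _ <-]; exact: enorm_ge0.
Qed.

(** A segment from [x] to a point outside [Omega] meets the boundary, at a distance from [x] not
    exceeding its length. *)
Lemma ball_edist_subset Omega x y : open Omega -> Omega x ->
  enorm (y - x) < edist_set x (boundary Omega) -> Omega y.
Proof.
move=> oO Ox xy; apply: contrapT => Oy.
have [a /andP[a0 a1] bd] := boundary_segment oO Ox Oy.
have := edist_set_le x bd; rewrite opprD addrA subrr sub0r enormN enormZ ger0_norm//.
apply/negP; rewrite -ltNge; apply: le_lt_trans xy.
by rewrite -[leRHS]mul1r ler_wpM2r// enorm_ge0.
Qed.

(** In positive dimension a bounded set misses a far constant vector, and a segment to it crosses
    the boundary. Without boundary points [edist_set] would be the infimum of an empty set. *)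
Lemma boundary_nonempty Omega : (0 < N)%N -> open Omega -> bounded_set Omega ->
  Omega !=set0 -> boundary Omega !=set0.
Proof.
move=> N0 oO bO [x Ox].
have [y Oy] : exists y, ~ Omega y.
  apply: contrapT => H.
  have {}H y : Omega y by apply: contrapT => Oy; apply: H; exists y.
  have [M [_ HM]] := bO.
  have := HM (`|M| + 1) _ (const_mx (`|M| + 2)) (H _).
  rewrite (le_lt_trans (ler_norm _)) ?ltrDl// => /(_ isT).
  apply/negP; rewrite -ltNge.
  have i0 : 'I_N by exact: Ordinal N0.
  apply: lt_le_trans (ler_coord_norm _ i0); rewrite mxE.
  rewrite [ltRHS]ger0_norm ?addr_ge0//.
  by rewrite ltrD2l ltr1n.
by have [a _ bd] := boundary_segment oO Ox Oy; eexists; exact: bd.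
Qed.

Lemma diam_ub Omega x y : bounded_set Omega -> Omega x -> Omega y ->
  enorm (x - y) <= diam Omega.
Proof.
move=> [M [_ HM]] Ox Oy; apply: sup_ubound; last by exists (x, y).
exists (N%:R * ((`|M| + 1) + (`|M| + 1))) => _ [[z w] [/= Oz Ow] <-].
apply: le_trans (enorm_le_normr _) _; apply: ler_wpM2l => //.
apply: le_trans (ler_normB _ _) _; apply: lerD; apply: HM => //;
  by rewrite (le_lt_trans (ler_norm _))// ltrDl.
Qed.

(** An open set contains none of its boundary points, so a ball about [x] inside [Omega] keeps the
    boundary away. *)
Lemma edist_set_gt0 Omega x : open Omega -> Omega x -> boundary Omega !=set0 ->
  0 < edist_set x (boundary Omega).
Proof.
move=> oO Ox [z0 bz0].
have /nbhs_ballP[e /= e0 xe] : nbhs x Omega by exact: open_nbhs_nbhs.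
apply: lt_le_trans e0 _; apply: lb_le_inf.
  by exists (enorm (x - z0)), z0.
move=> _ [z [_ bz] <-]; apply: contrapT => /negP; rewrite -ltNge => xz.
apply: bz; rewrite (interior_id _).1//.
apply: xe; apply/rv_ballP; exact: le_lt_trans (normr_le_enorm _) xz.
Qed.

(** The supremum is meaningful once the distances are bounded above, which is seen by measuring to
    one fixed boundary point [z]. Halving it yields a point that beats the bound strictly, so no
    maximizer has to be found. *)
Lemma inradius_center Omega : (0 < N)%N -> open Omega -> bounded_set Omega ->
  Omega !=set0 -> 0 < inradius Omega /\ exists2 x, Omega x &
    forall y, enorm (y - x) < inradius Omega / 2 -> Omega y.
Proof.
move=> N0 oO bO nO.
have bd := boundary_nonempty N0 oO bO nO.
have [x Ox] := nO; have [z bz] := bd.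
pose S := [set edist_set x (boundary Omega) | x in Omega].
have supS : has_sup S.
  split; first by exists (edist_set x (boundary Omega)), x.
  have [M [_ HM]] := bO.
  exists (N%:R * ((`|M| + 1) + `|z|)) => _ [y Oy <-].
  apply: le_trans (edist_set_le _ bz) _; apply: le_trans (enorm_le_normr _) _.
  apply: ler_wpM2l => //; apply: le_trans (ler_normB _ _) _; rewrite lerD2r.
  by apply: HM => //; rewrite (le_lt_trans (ler_norm _))// ltrDl.
have r0 : 0 < inradius Omega.
  apply: lt_le_trans (edist_set_gt0 oO Ox bd) _.
  by apply: sup_upper_bound => //; exists x.
split => //.
have [_ [y Oy <-] ry] : exists2 e, S e & inradius Omega / 2 < e.
  by apply: lt_sup_ex => //; rewrite -/(inradius Omega); lra.
by exists y => // w wy; apply: (ball_edist_subset oO Oy); exact: lt_trans ry.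
Qed.

End inradius.

Lemma measurable_fun_flip d1 d2 d3 (T1 : measurableType d1) (T2 : measurableType d2)
    (T3 : measurableType d3) (f : T1 -> T2 -> T3) :
  measurable_fun setT (fun z : T1 * T2 => f z.1 z.2) ->
  measurable_fun setT (fun z : T2 * T1 => f z.2 z.1).
Proof. by move=> mf; exact: (measurableT_comp mf (@measurable_swap _ _ T2 T1)). Qed.

Section product_sigma_finite.
Context d1 d2 (T1 : measurableType d1) (T2 : measurableType d2) (R : realType).
Variables (m1 : {sigma_finite_measure set T1 -> \bar R})
  (m2 : {sigma_finite_measure set T2 -> \bar R}).
Local Open Scope ereal_scope.

(* An alias on which the product measure is registered as sigma-finite. *)
Definition sigma_finite_prod : set (T1 * T2) -> \bar R := (m1 \x m2)%E.

HB.instance Definition _ := Measure.on sigma_finite_prod.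

Lemma sigma_finite_prodT : sigma_finite setT sigma_finite_prod.
Proof.
have /sigma_finiteP[F [TF ndF Foo]] := sigma_finiteT m1.
have /sigma_finiteP[G [TG ndG Goo]] := sigma_finiteT m2.
exists (fun k => F k `*` G k).
  rewrite -setXTT TF TG predeqE => -[x y]; split.
    move=> [/= [k _ Fkx] [l _ Gly]]; exists (maxn k l) => //; split.
    - by move: x Fkx; exact/subsetPset/ndF/leq_maxl.
    - by move: y Gly; exact/subsetPset/ndG/leq_maxr.
  by move=> [k _ []/= ? ?]; split; exists k.
move=> k; have [? ?] := Foo k; have [? ?] := Goo k.
split; first exact: measurableX.
by rewrite /sigma_finite_prod product_measure1E// lte_mul_pinfty// ge0_fin_numE.
Qed.

HB.instance Definition _ := Measure_isSigmaFinite.Build _ _ _ sigma_finite_prod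
  sigma_finite_prodT.

End product_sigma_finite.

(** * From the local estimate to the interpolation norm *)

Section near_diagonal.
Variables (R : realType) (N : nat).
Local Open Scope ereal_scope.
Local Notation mu := (lebesgue_rv R N).
Implicit Types (Omega : set 'rV[R]_N) (u : 'rV[R]_N -> R).

Definition near_diag (a : R) (z : 'rV[R]_N * 'rV[R]_N) : R :=
  (enorm (z.1 - z.2) <= a)%R%:R.

(** The double integral of the local estimate. It runs over all pairs of the whole space, since a
    point of [Omega] may be compared with one outside. *)
Definition local_energy p u (a : R) : \bar R :=
  \int[mu \x mu]_z (near_diag a z * `|u z.1 - u z.2| `^ p)%:E.

Lemma measurable_diff_powR p u : measurable_fun setT u ->
  measurable_fun setT
    (fun z : 'rV[R]_N * 'rV[R]_N => `|u z.1 - u z.2| `^ p)%R.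
Proof.
move=> mu_; apply/measurable_EFinP; apply: measurable_abs_powR.
apply: measurable_funB.
  exact: (measurableT_comp mu_ measurable_fst).
exact: (measurableT_comp mu_ measurable_snd).
Qed.

Lemma measurable_enormB :
  measurable_fun setT (fun z : 'rV[R]_N * 'rV[R]_N => enorm (z.1 - z.2)).
Proof.
apply: (measurableT_comp (@measurable_enorm R N)).
by apply: measurable_fun_rvB; [exact: measurable_fst|exact: measurable_snd].
Qed.

Lemma integral_inv_sqr (a : R) : (0 < a)%R ->
  \int[lebesgue_measure]_(t in `[a, +oo[) ((t ^+ 2)^-1)%:E = (a^-1)%:E.
Proof.
move=> a0.
have dF (x : R) : (0 < x)%R -> is_derive x 1%R (fun x : R => - x^-1)%R (x ^+ 2)^-1%R.
  move=> x0; have xN0 : x != 0%R by rewrite gt_eqF.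
  apply: is_derive_eq; first by apply: is_deriveN; apply: is_deriveV.
  by rewrite scaleNr opprK /GRing.scale /= mulr1.
have cF (x : R) : (0 < x)%R -> {for x, continuous (fun x : R => - x^-1)%R}.
  move=> x0; apply: differentiable_continuous; apply/derivable1_diffP.
  by case: (dF x x0).
rewrite (@ge0_continuous_FTC2y R (fun t => (t ^+ 2)^-1)%R (fun t => - t^-1)%R a 0%R).
- by rewrite -EFinB sub0r opprK.
- by move=> x _; rewrite invr_ge0 sqr_ge0.
- apply: continuous_in_subspaceT => x; rewrite inE /= in_itv /= andbT => ax.
  have x0 : (0 < x)%R by exact: lt_le_trans ax.
  apply: cvgV; first by rewrite expf_neq0// gt_eqF.
  exact: exprn_continuous.
- rewrite -[X in _ --> X]oppr0; apply: cvgN.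
  apply/(gtr0_cvgV0 (f := id)); last exact: cvg_id.
  exact: nbhs_pinfty_gt.
- by move=> x ax; case: (dF x (lt_trans a0 ax)).
- by apply: cvg_at_right_filter; exact: cF.
move=> x xa; rewrite derive1E.
have ax : (a < x)%R by move: xa; rewrite in_itv /= andbT.
by case: (dF x (lt_trans a0 ax)).
Qed.

(** The exact value has a further factor [1 / al]. For [al >= 1] it can be given up: the power
    [al - 1] is bounded by its value at [a], and the inverse square remains. The bound has no
    constant depending on [s]. *)
Lemma integral_tail_powR (al a : R) : (1 <= al)%R -> (0 < a)%R ->
  \int[lebesgue_measure]_(t in `[a, +oo[) ((t `^ al)^-1 * t^-1)%:E <=
  ((a `^ al)^-1)%:E.
Proof.
move=> al1 a0.
have H (t : R) : (a <= t)%R ->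
    ((t `^ al)^-1 * t^-1 <= (a `^ (al - 1))^-1 * (t ^+ 2)^-1)%R.
  move=> at_; have t0 : (0 < t)%R by exact: lt_le_trans at_.
  rewrite -(@mulr_powRB1 _ t al (ltW t0)); last lra.
  rewrite invfM mulrAC -invfM -expr2 mulrC ler_wpM2r ?invr_ge0 ?sqr_ge0//.
  have pa : (0 < a `^ (al - 1))%R by exact: powR_gt0.
  apply: (ler_inv_anti pa); apply: ler_powR_base; [lra|exact: ltW|exact: at_].
have mq : measurable_fun [set: measurableTypeR R] (fun t : R => ((t ^+ 2)^-1)%:E : \bar R).
  by apply/measurable_EFinP; apply: measurable_inv_R; exact: measurable_funX.
apply: (@le_trans _ _ (\int[lebesgue_measure]_(t in `[a, +oo[)
    (((a `^ (al - 1))^-1)%:E * ((t ^+ 2)^-1)%:E))).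
  apply: ge0_le_integral => //.
  - move=> t /=; rewrite in_itv /= andbT => at_.
    by rewrite lee_fin mulr_ge0// invr_ge0 ?powR_ge0// ltW// (lt_le_trans a0).
  - apply: (@measurable_funTS _ _ (measurableTypeR R)).
    apply/measurable_EFinP; apply: measurable_funM; exact: measurable_inv_R.
  - apply: (@measurable_funTS _ _ (measurableTypeR R)); exact: measurable_funeM.
  move=> t /=; rewrite in_itv /= andbT => at_.
  by rewrite -EFinM lee_fin; exact: H.
rewrite ge0_integralZl_EFin//.
- rewrite integral_inv_sqr// -EFinM lee_fin -invfM mulrC mulr_powRB1//.
    exact: ltW.
  lra.
- by move=> t _; rewrite lee_fin invr_ge0 sqr_ge0.
- apply: (@measurable_funTS _ _ (measurableTypeR R)); exact: mq.
- by rewrite invr_ge0 powR_ge0.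
Qed.

Lemma Xsp_le_Dsp_of_local (p s C M : R) Omega u : (0 < N)%N ->
  (1 < p)%R -> (0 < s)%R -> (s < 1)%R -> (0 < C)%R -> (1 <= M)%R ->
  measurable_fun setT u ->
  (forall t : R, (0 < t)%R -> K_functional p Omega t u `^ p <=
     (C * (t ^+ N)^-1)%:E * local_energy p u (M * t)) ->
  Xsp_norm s p Omega u `^ p <=
  (C * M `^ (N%:R + p))%:E * Dsp_norm s p u `^ p.
Proof.
move=> N0 p1 s0 s1 C0 M1 mu_ HK; have p0 : (0 < p)%R by lra.
have M0 : (0 < M)%R by lra.
pose al : R := (N%:R + s * p)%R.
(* The lower bound comes from [N >= 1], the upper one from [s < 1]; together with [M >= 1] they free
   the constant from [s]. *)
have al1 : (1 <= al)%R.
  by rewrite (@le_trans _ _ N%:R)// ?ler1n// lerDl mulr_ge0// ltW.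
have alp : (al <= N%:R + p)%R.
  by rewrite lerD2l -[leRHS]mul1r ler_wpM2r// ltW.
rewrite Xsp_norm_poweR// Dsp_norm_poweR//.
pose D (z : 'rV[R]_N * 'rV[R]_N) : R := (`|u z.1 - u z.2| `^ p)%R.
have D0 z : (0 <= D z)%R by exact: powR_ge0.
have mD : measurable_fun setT D by exact: measurable_diff_powR.
pose w (t : R) : R := ((t `^ al)^-1 * t^-1)%R.
have mI : measurable ([set` `]0%R, +oo[%R] : set R) by exact: measurable_itv.
have mw : measurable_fun [set: measurableTypeR R] w.
  apply: measurable_funM; exact: measurable_inv_R.
have w0 (t : R) : (0 < t)%R -> (0 <= w t)%R.
  by move=> t0; rewrite mulr_ge0// invr_ge0 ?powR_ge0// ltW.
pose g (t : R) (z : 'rV[R]_N * 'rV[R]_N) : \bar R :=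
  (near_diag (M * t) z * D z * w t)%:E.
have nd0 a z : (0 <= near_diag a z)%R by [].
have mnd : measurable_fun setT
    (fun q : measurableTypeR R * ('rV[R]_N * 'rV[R]_N) => near_diag (M * q.1) q.2).
  rewrite (_ : (fun _ => _) = \1_[set q : measurableTypeR R * ('rV[R]_N * 'rV[R]_N) |
      enorm (q.2.1 - q.2.2) <= M * q.1]%R).
    apply: measurable_indic; apply: measurable_le_set.
      exact: (measurableT_comp measurable_enormB measurable_snd).
    by apply: measurable_funM => //; exact: measurable_fst.
  apply/funext => q; rewrite indicE /near_diag; congr (_%:R).
  by case: (boolP (enorm (q.2.1 - q.2.2) <= M * q.1)%R) => H;
    [rewrite mem_set|rewrite memNset//; exact/negP].
have mg : measurable_fun setT
    (fun q : measurableTypeR R * ('rV[R]_N * 'rV[R]_N) => g q.1 q.2).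
  apply/measurable_EFinP; apply: measurable_funM.
    apply: measurable_funM => //.
    exact: (measurableT_comp mD measurable_snd).
  exact: (measurableT_comp mw measurable_fst).
have mg' : measurable_fun setT
    (fun q : ('rV[R]_N * 'rV[R]_N) * measurableTypeR R => g q.2 q.1).
  exact: (measurable_fun_flip mg).
(* Nonnegative for every real [t]: for [t < 0] no distance is below [M * t], and at [t = 0] the
   weight is 0 by [0^-1 = 0]. *)
have g0 (t : R) z : 0 <= g t z.
  rewrite lee_fin; case: (ltgtP (0 : R)%R t) => [t0|t0|<-].
  - by rewrite mulr_ge0 ?w0// mulr_ge0.
  - have Mt : (M * t < 0)%R by rewrite pmulr_rlt0.
    rewrite /near_diag [(enorm _ <= _)%R](_ : _ = false) ?mul0r//.
    by apply/negbTE; rewrite -ltNge (lt_le_trans Mt)// enorm_ge0.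
  - by rewrite /w invr0 !mulr0.
have step1 (t : R) : (0 < t)%R ->
    X_weight s p Omega u t <= C%:E * \int[mu \x mu]_z g t z.
  move=> t0; rewrite X_weightE//.
  apply: (@le_trans _ _ ((((t `^ s) `^ p)^-1 * t^-1)%:E *
      ((C * (t ^+ N)^-1)%:E * local_energy p u (M * t)))).
    apply: lee_wpmul2l; last exact: HK.
    by rewrite lee_fin mulr_ge0// invr_ge0 ?powR_ge0// ltW.
  rewrite muleA -EFinM.
  rewrite [X in X%:E * _](_ : _ = C * w t)%R; last first.
    rewrite /w /al powRD; last by rewrite (gt_eqF t0) implybT.
    by rewrite powR_mulrn ?(ltW t0)// powRrM !invfM; ring.
  rewrite EFinM -muleA; apply: lee_wpmul2l; first by rewrite lee_fin ltW.
  rewrite /local_energy -ge0_integralZl_EFin//.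
  - rewrite le_eqVlt; apply/orP; left; apply/eqP; apply: eq_integral => z _.
    by rewrite /g -EFinM mulrC.
  - by move=> z _; rewrite lee_fin mulr_ge0.
  - apply/measurable_EFinP; apply: measurable_funM => //.
    exact: (measurableT_comp mnd (measurable_pair1 t)).
  - exact: w0.
pose F (z : 'rV[R]_N * 'rV[R]_N) : \bar R := (D z / enorm (z.1 - z.2) `^ al)%:E.
have mF : measurable_fun setT F.
  apply/measurable_EFinP; apply: measurable_funM => //; apply: measurable_inv_R.
  exact: (measurableT_comp (measurable_powR _) measurable_enormB).
have mIg : measurable_fun [set: measurableTypeR R] (fun t : R => \int[mu \x mu]_z g t z).
  exact: (measurable_integral_in (sigma_finite_prod mu mu) measurableT mg
    (fun t z _ => g0 t z)).
apply: (@le_trans _ _ (C%:E * \int[lebesgue_measure]_(t in `]0%R, +oo[)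
    \int[mu \x mu]_z g t z)).
  rewrite -ge0_integralZl_EFin//; last 3 first.
  - by move=> t _; apply: integral_ge0 => z _; exact: g0.
  - exact: (@measurable_funTS _ _ (measurableTypeR R)).
  - exact: ltW.
  apply: ge0_le_integral => //.
  - by move=> t /=; rewrite in_itv /= andbT => t0; exact: X_weight_ge0.
  - exact: (measurable_funTS (measurable_X_weight s p Omega u)).
  - by apply: (@measurable_funTS _ _ (measurableTypeR R)); exact: measurable_funeM.
  by move=> t /=; rewrite in_itv /= andbT => t0; exact: step1.
rewrite EFinM -muleA; apply: lee_wpmul2l; first by rewrite lee_fin ltW.
have swap := @tonelli_in _ _ _ _ _ (sigma_finite_prod mu mu) lebesgue_measure _
  (fun z t => g t z) mI mg' (fun z t _ => g0 t z).
rewrite [leLHS](_ : _ = \int[mu \x mu]_z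
  \int[lebesgue_measure]_(t in `]0%R, +oo[) g t z); last exact: (esym swap).
rewrite -ge0_integralZl_EFin ?powR_ge0//; last first.
  by move=> z _; rewrite lee_fin divr_ge0// powR_ge0.
apply: ge0_le_integral => //.
- by move=> z _; apply: integral_ge0.
- exact: measurable_integral_in.
- exact: measurable_funeM.
move=> z _.
(* On the diagonal the difference of [u] vanishes and both sides are 0; off it, [r / M] is a
   positive lower limit for the tail integral. *)
have [z0|z0] := eqVneq (enorm (z.1 - z.2)) 0%R.
  have Dz : D z = 0%R.
    rewrite /D (_ : z.1 = z.2) ?subrr ?normr0 ?powR0 ?gt_eqF//.
    apply/eqP; rewrite -subr_eq0 -normr_eq0 eq_le normr_ge0 andbT -z0.
    exact: normr_le_enorm.
  rewrite integral0_eq; last by move=> t _; rewrite /g Dz mulr0 mul0r.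
  by rewrite -/(D z) Dz mul0r mule0.
set r := enorm (z.1 - z.2).
have r0 : (0 < r)%R by rewrite lt_def z0 enorm_ge0.
have rM : r = (M * (r / M))%R by field; rewrite gt_eqF.
have a0 : (0 < r / M)%R by exact: divr_gt0.
(* The cut-off [r <= M * t] becomes the lower limit of integration in [t]. *)
have -> : \int[lebesgue_measure]_(t in `]0%R, +oo[) g t z =
    \int[lebesgue_measure]_(t in `[(r / M)%R, +oo[) ((D z)%:E * (w t)%:E).
  rewrite [LHS]integral_mkcond [RHS]integral_mkcond; apply: eq_integral => t _.
  rewrite !patchE; case: (boolP (t \in [set` `[(r / M)%R, +oo[%R])) => ta.
    move: ta => /set_mem /=; rewrite in_itv /= andbT => ta.
    rewrite mem_set /=; last by rewrite in_itv /= andbT; exact: lt_le_trans ta.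
    have rt : (r <= M * t)%R by rewrite [leRHS]mulrC -ler_pdivrMr.
    by rewrite /g /near_diag -/r rt mul1r EFinM.
  have rt : (r <= M * t)%R = false.
    apply: contraNF ta => rt; apply/mem_set.
    by rewrite /= in_itv /= andbT ler_pdivrMr// mulrC.
  by case: ifPn => // _; rewrite /g /near_diag -/r rt !mul0r.
rewrite ge0_integralZl_EFin//; last 2 first.
- move=> t /=; rewrite in_itv /= andbT => ta; rewrite lee_fin w0//.
  exact: lt_le_trans ta.
- apply: (@measurable_funTS _ _ (measurableTypeR R)).
  exact/measurable_EFinP.
apply: (@le_trans _ _ ((D z)%:E * (((r / M) `^ al)^-1)%:E)).
  by apply: lee_wpmul2l; [rewrite lee_fin|exact: integral_tail_powR].
rewrite -!EFinM lee_fin mulrCA; apply: ler_wpM2l => //.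
have ra : (r `^ al = M `^ al * (r / M) `^ al)%R.
  by rewrite {1}rM powRM// ltW.
have Mal : (0 < M `^ al)%R by exact: powR_gt0.
have aal : (0 < (r / M) `^ al)%R by exact: powR_gt0.
rewrite -/r -/al ra invfM.
apply: (@le_trans _ _ (M `^ al * ((M `^ al)^-1 * ((r / M) `^ al)^-1)))%R.
  by rewrite mulrA divff ?mul1r// gt_eqF.
apply: ler_wpM2r; first by rewrite mulr_ge0// invr_ge0 ltW.
by apply: ler_powR; [exact: M1|exact: alp].
Qed.

End near_diagonal.

(** * The mollified dilation *)

Section mollifier.
Variables (R : realType) (N : nat).
Local Notation mu := (lebesgue_rv R N).
Implicit Types (u rho g : 'rV[R]_N -> R) (x y h b : 'rV[R]_N) (t k : R).
Local Notation e_ i := (delta_mx ord0 i : 'rV[R]_N).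

(** A tent that is at least 1 on the cube of half-width [t], vanishes off the one of half-width
    [2 * t] and has slope [1 / t]. Its translates by at most [t] vanish off the cube of half-width
    [3 * t], whence the 3 below. *)
Definition bump t y : R := Num.max 0 (2 - `|y| / t).

Lemma bump_ge0 t y : 0 <= bump t y.
Proof. by rewrite le_max lexx. Qed.

Lemma bump_le2 t y : 0 < t -> bump t y <= 2.
Proof.
move=> t0; rewrite ge_max; apply/andP; split; first lra.
by rewrite gerBl divr_ge0// ltW.
Qed.

Lemma bump_out t y : 0 < t -> 2 * t < `|y| -> bump t y = 0.
Proof.
move=> t0 ty; apply/max_idPl; rewrite subr_le0 ler_pdivlMr//; exact: ltW.
Qed.

Lemma bump_ge1 t y : 0 < t -> `|y| <= t -> 1 <= bump t y.
Proof.
move=> t0 ty; rewrite le_max; apply/orP; right.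
have : `|y| / t <= 1 by rewrite ler_pdivrMr// mul1r.
lra.
Qed.

Lemma bump_lipschitz t y h : 0 < t -> `|bump t (y - h) - bump t y| <= `|h| / t.
Proof.
move=> t0; have H (a c d : R) : `|a - c| <= d ->
    `|Num.max 0 (2 - a) - Num.max 0 (2 - c)| <= d.
  rewrite !ler_norml => /andP[h1 h2].
  by rewrite !/Num.max; case: ltP => ?; case: ltP => ?; apply/andP; split; lra.
apply: H; rewrite -mulrBl normrM normfV (gtr0_norm t0) ler_wpM2r ?invr_ge0 ?(ltW t0)//.
by rewrite (le_trans (ler_dist_dist _ _))// addrAC subrr sub0r normrN.
Qed.

Lemma measurable_bump t : measurable_fun setT (bump t).
Proof.
apply: measurable_maxr => //; apply: measurable_funB => //.
by apply: measurable_funM => //; exact: measurable_normr_rv.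
Qed.

Lemma bump_le_cube t y : 0 < t -> bump t y <= 2 * cube_ind (2 * t) y.
Proof.
move=> t0; rewrite /cube_ind; case: (leP `|y| (2 * t)) => ty /=; first by rewrite mulr1 bump_le2.
by rewrite mulr0 bump_out.
Qed.

Lemma bump_kernel t : 0 < t -> kernel_fun (bump t).
Proof.
move=> t0; split; first exact: measurable_bump.
exists (2 * t), 2; split => //; first by rewrite mulr_ge0// ltW.
by move=> y; rewrite ger0_norm ?bump_ge0// bump_le_cube.
Qed.

Lemma cube_kernel a : 0 <= a -> kernel_fun (@cube_ind R N a).
Proof.
move=> a0; split; first exact: measurable_cube_ind.
by exists a, 1; split => // y; rewrite mul1r ger0_norm ?cube_ind_ge0.
Qed.

(** The factor 1 is kept so that the lemmas on a kernel times a bounded function apply. *)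
Definition bump_mass t : R := \int[mu]_y (bump t y * 1).

Lemma bump_mass_ge t : 0 < t -> (2 * t) ^+ N <= bump_mass t.
Proof.
move=> t0; rewrite /bump_mass.
have b1 : measurable_fun [set: 'rV[R]_N] (cst (1 : R)) by [].
have b1' (y : 'rV[R]_N) : `|cst (1 : R) y| <= 1 by rewrite normr1.
have ib := integrable_kernelM (bump_kernel t0) b1 b1'.
have ic := integrable_kernelM (cube_kernel (ltW t0)) b1 b1'.
have -> : (2 * t) ^+ N = \int[mu]_y (cube_ind t y * 1).
  rewrite /Rintegral (eq_integral (fun y => (cube_ind t y)%:E)) => [|y _].
    by rewrite integral_cube_ind// ltW.
  by rewrite mulr1.
apply: le_Rintegral => // y _; rewrite !mulr1 /cube_ind.
by case: (leP `|y| t) => yt; [exact: bump_ge1|exact: bump_ge0].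
Qed.

Lemma Rintegral_kernel_dom rho sigma g (c : R) : 0 <= c ->
  kernel_fun rho -> kernel_fun sigma -> bounded_fun g ->
  (forall y, `|rho y| <= c * sigma y) ->
  `|\int[mu]_y (rho y * g y)| <= c * \int[mu]_y (sigma y * `|g y|).
Proof.
move=> c0 kr ks [mg [G gG]] rs.
have mg' : measurable_fun setT (fun y => `|g y|) by exact: measurableT_comp.
have gG' y : `| `|g y| | <= G by rewrite normr_id.
have i1 := integrable_kernelM kr mg gG.
have i2 := integrable_kernelM ks mg' gG'.
apply: le_trans (le_normr_Rintegral measurableT i1) _.
rewrite -RintegralZl//; apply: le_Rintegral => //.
- by have := integrable_norm i1.
- exact: (integrableZl measurableT c i2).
by move=> y _; rewrite normrM mulrA ler_wpM2r.
Qed.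

Lemma Rintegral_rvD (f : 'rV[R]_N -> R) h : measurable_fun setT f ->
  \int[mu]_y f (y + h) = \int[mu]_y f y.
Proof.
move=> mf; rewrite /Rintegral; congr fine.
apply: (integral_rvD h (f := EFin \o f)); exact/measurable_EFinP.
Qed.

Variables (t k : R) (b : 'rV[R]_N).
Hypothesis t0 : 0 < t.

Let m := bump_mass t.

Let m0 : 0 < m.
Proof. by apply: lt_le_trans (bump_mass_ge t0); rewrite exprn_gt0// mulr_gt0. Qed.

Definition mollify u : 'rV[R]_N -> R := conv k b (fun y => m^-1 * bump t y) u.

(** The common majorant: divided by [bump_mass] it bounds, up to constants, both the distance from
    [u] to its mollification and [t] times the gradient of the latter. *)
Definition oscillation u x : R :=
  \int[mu]_y (cube_ind (3 * t) y * `|u (k *: (x + y) + b) - u x|).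

Let rho y := m^-1 * bump t y.

Let kr : kernel_fun rho.
Proof. by apply: kernel_funZ; exact: bump_kernel. Qed.

Let kc : kernel_fun (@cube_ind R N (3 * t)).
Proof. by apply: cube_kernel; rewrite mulr_ge0// ltW. Qed.

Lemma bounded_cst (c : R) : bounded_fun (fun _ : 'rV[R]_N => c).
Proof. by split => //; exists `|c|. Qed.

(** The normalized kernel has total mass 1, so a constant can be moved under the integral. *)
Lemma mollify_sub u x (c : R) : test_fun u ->
  mollify u x - c = \int[mu]_y (rho y * (u (k *: (x + y) + b) - c)).
Proof.
move=> tu; rewrite -Rintegral_kernelB//; last 2 first.
- exact: bounded_conv_arg.
- exact: bounded_cst.
congr (_ - _).
have bk := bump_kernel t0.
transitivity (m^-1 * (c * \int[mu]_y (bump t y * 1))).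
  by rewrite -/(bump_mass t) -/m mulrCA mulVf ?mulr1// gt_eqF.
rewrite (Rintegral_kernelZ _ bk); last exact: bounded_cst.
rewrite (Rintegral_kernelZ _ bk); last exact: bounded_cst.
by apply: eq_Rintegral => y _; rewrite /rho mulr1 [RHS]mulrAC mulrC.
Qed.

Lemma oscillation_ge0 u x : 0 <= oscillation u x.
Proof. by apply: Rintegral_ge0 => y _; rewrite mulr_ge0// cube_ind_ge0. Qed.

Lemma mollify_dist u x : test_fun u ->
  `|u x - mollify u x| <= 2 * (m^-1 * oscillation u x).
Proof.
move=> tu; rewrite distrC mollify_sub// mulrA.
apply: Rintegral_kernel_dom => //.
- by rewrite mulr_ge0// invr_ge0 ltW.
- by apply: bounded_funB; [exact: bounded_conv_arg|exact: bounded_cst].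
move=> y; rewrite normrM ger0_norm ?invr_ge0 ?(ltW m0)// ger0_norm ?bump_ge0//.
rewrite mulrAC mulrC; apply: ler_wpM2r; first by rewrite invr_ge0 ltW.
apply: le_trans (bump_le_cube _ t0) _; apply: ler_wpM2l => //.
rewrite /cube_ind ler_nat; case: (leP `|y| (2 * t)) => // ty.
by rewrite (le_trans ty)// ler_wpM2r ?(ltW t0)//; lra.
Qed.

(** A change of variable moves the shift [h] from [u] to the kernel, whose Lipschitz bound yields
    [|h| / t]. Subtracting [u x] inside, possible since both kernels have the same mass, leaves the
    oscillation; no derivative of [u] appears. *)
Lemma mollify_increment u x h : test_fun u -> `|h| <= t ->
  `|mollify u (x + h) - mollify u x| <= m^-1 * oscillation u x / t * `|h|.
Proof.
move=> tu ht.
pose g y := u (k *: (x + y) + b) - u x.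
have bg : bounded_fun g.
  by apply: bounded_funB; [exact: bounded_conv_arg|exact: bounded_cst].
have krh : kernel_fun (fun y => rho (y - h)).
  split.
    apply: measurable_funM => //; apply: (measurableT_comp (@measurable_bump t)).
    exact: measurable_fun_rvB.
  exists (3 * t), (m^-1 * 2); split; first by rewrite mulr_ge0// ltW.
    by rewrite mulr_ge0// invr_ge0 ltW.
  move=> y; rewrite normrM ger0_norm ?invr_ge0 ?(ltW m0)// ger0_norm ?bump_ge0//.
  rewrite -mulrA; apply: ler_wpM2l; first by rewrite invr_ge0 ltW.
  rewrite /cube_ind; case: (leP `|y| (3 * t)) => yt /=; first by rewrite mulr1 bump_le2.
  rewrite mulr0 bump_out//; have := lerB_normD y (- h); rewrite normrN.
  by move: yt ht; set p := `|y|; set q := `|h|; set r := `|_|; lra.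
have E1 : mollify u (x + h) - u x = \int[mu]_y (rho (y - h) * g y).
  rewrite -[RHS](Rintegral_rvD h); last first.
    by apply: measurable_funM; [case: krh|case: bg].
  rewrite mollify_sub//; apply: eq_Rintegral => y _.
  by rewrite addrK /g addrA [x + y + h]addrAC.
have dom y : `|rho (y - h) - rho y| <= m^-1 * (`|h| / t) * cube_ind (3 * t) y.
  rewrite -mulrBr normrM ger0_norm ?invr_ge0 ?(ltW m0)// -mulrA.
  apply: ler_wpM2l; first by rewrite invr_ge0 ltW.
  rewrite /cube_ind; case: (leP `|y| (3 * t)) => yt /=.
    by rewrite mulr1 bump_lipschitz.
  rewrite mulr0 !bump_out// ?subrr ?normr0//; first by move: yt t0; lra.
  have := lerB_normD y (- h); rewrite normrN.
  by move: yt ht; set p := `|y|; set q := `|h|; set r := `|_|; lra.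
have c0 : 0 <= m^-1 * (`|h| / t).
  by rewrite mulr_ge0// ?invr_ge0 ?(ltW m0)// divr_ge0// ltW.
have kd : kernel_fun (fun y => rho (y - h) - rho y).
  split; first by apply: measurable_funB; [case: krh|case: kr].
  by exists (3 * t), (m^-1 * (`|h| / t)); split => //; rewrite mulr_ge0// ltW.
rewrite [X in `|X|](_ : _ = \int[mu]_y ((rho (y - h) - rho y) * g y)); last first.
  have -> : mollify u (x + h) - mollify u x =
      (mollify u (x + h) - u x) - (mollify u x - u x) by ring.
  have [mg [G gG]] := bg.
  rewrite E1 (mollify_sub x (u x) tu) -/g -RintegralB//.
  - by apply: eq_Rintegral => y _; rewrite mulrBl.
  - exact: integrable_kernelM krh mg gG.
  - exact: integrable_kernelM kr mg gG.
rewrite [leRHS](_ : _ = (m^-1 * (`|h| / t)) * oscillation u x); last by ring.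
exact: Rintegral_kernel_dom.
Qed.

Lemma partial_deriv_le u i x (c e : R) : 0 < e -> derivable u x (e_ i) ->
  (forall h : R, `|h| <= e -> `|u (x + h *: e_ i) - u x| <= c * `|h|) ->
  `|partial_deriv i u x| <= c.
Proof.
move=> e0 du uc; rewrite /partial_deriv /derive -lim_norm//.
apply: limr_le; first exact: is_cvg_norm.
near=> h.
have h0 : h != 0 by near: h; exact: nbhs_dnbhs_neq.
have he : `|h| <= e by near: h; exact: dnbhs0_le.
rewrite normrZ normfV ler_pdivrMl ?normr_gt0// [leRHS]mulrC.
by have := uc h he; rewrite /= [x + _]addrC.
Unshelve. all: end_near. Qed.

Lemma mollify_gradient u x : test_fun u ->
  t * enorm (gradient (mollify u) x) <= N%:R * (m^-1 * oscillation u x).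
Proof.
move=> tu.
have A0 : 0 <= m^-1 * oscillation u x.
  by rewrite mulr_ge0 ?oscillation_ge0// invr_ge0 ltW.
rewrite mulrC -ler_pdivlMr// -mulrA.
apply: le_trans (enorm_le_normr _) _; apply: ler_wpM2l => //.
apply: rv_norm_le; first by rewrite divr_ge0// ltW.
move=> i; rewrite mxE; apply: (partial_deriv_le t0).
  by case: (conv_derive k b i x kr tu).
move=> h ht; apply: le_trans (mollify_increment x tu _) _.
  rewrite normrZ; apply: le_trans _ ht.
  by rewrite -[leRHS]mulr1 ler_wpM2l// normr_delta_le.
apply: ler_wpM2l; first by rewrite divr_ge0// ltW.
by rewrite normrZ -[leRHS]mulr1 ler_wpM2l// normr_delta_le.
Qed.

(** With [q = (2 * t)^N], the mass of the bump is at least [q] and the cube of half-width [3 * t]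
    has measure [3^N q]; Jensen gives [q^(-p) (3^N q)^(p - 1)], the stated constant. *)
Lemma oscillation_powR u x p : 1 < p -> test_fun u ->
  (((m^-1 * oscillation u x) `^ p)%:E <=
   ((3 ^+ N) `^ (p - 1) / (2 * t) ^+ N)%:E *
   \int[mu]_y (cube_ind (3 * t) y * `|u (k *: (x + y) + b) - u x| `^ p)%:E)%E.
Proof.
move=> p1 tu; have p0 : 0 < p by lra.
pose q := (2 * t) ^+ N.
have q0 : 0 < q by rewrite exprn_gt0// mulr_gt0.
pose g y := u (k *: (x + y) + b) - u x.
have bg : bounded_fun g.
  by apply: bounded_funB; [exact: bounded_conv_arg|exact: bounded_cst].
pose Q : set 'rV[R]_N := [set y | `|y| <= 3 * t].
have mQ : measurable Q by exact: measurable_cube.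
have muQ : mu Q = (3 ^+ N * q)%:E.
  rewrite [LHS]lebesgue_rv_cube; last by rewrite mulr_ge0// ltW.
  by rewrite /q -exprMn; congr ((_ ^+ N)%:E); ring.
have E (f : 'rV[R]_N -> R) : (\int[mu]_y (cube_ind (3 * t) y * f y)%:E =
    \int[mu]_(y in Q) (f y)%:E)%E.
  rewrite [RHS]integral_mkcond; apply: eq_integral => y _.
  rewrite patchE cube_indE indicE; case: (y \in Q); rewrite ?mul1r ?mul0r//.
have mg : measurable_fun setT (fun y => `|g y|) by apply: measurableT_comp => //; case: bg.
have J := jensen_powR p1 mQ muQ mg (fun y => normr_ge0 _).
have osc : ((oscillation u x)%:E = \int[mu]_(y in Q) (`|g y|)%:E)%E.
  rewrite -E /oscillation /Rintegral fineK//.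
  have [mg' [G gG]] := bg.
  apply: (integrable_fin_num measurableT).
  by apply: (integrable_kernelM kc mg (G := G)) => y; rewrite normr_id.
rewrite -osc in J.
apply: (@le_trans _ _ (((q^-1 * oscillation u x) `^ p)%:E)).
  rewrite lee_fin; apply: ler_powR_base; first exact: ltW.
    by rewrite mulr_ge0 ?oscillation_ge0// invr_ge0 ltW.
  apply: ler_wpM2r; first exact: oscillation_ge0.
  exact: (ler_inv_anti q0 (bump_mass_ge t0)).
rewrite powRM ?oscillation_ge0 ?invr_ge0 ?(ltW q0)// EFinM.
apply: (@le_trans _ _ (((q^-1) `^ p)%:E * (((3 ^+ N * q) `^ (p - 1))%:E *
    \int[mu]_(y in Q) (`|g y| `^ p)%:E))%E).
  by apply: lee_wpmul2l; [rewrite lee_fin powR_ge0|exact: J].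
rewrite muleA -EFinM -E -/q.
rewrite [X in (X%:E * _ <= _)%E](_ : _ = (3 ^+ N) `^ (p - 1) / q)//.
have N3 : 0 <= 3 ^+ N :> R by rewrite exprn_ge0.
rewrite powRM ?(ltW q0)// mulrCA; congr (_ * _).
have qp : q^-1 `^ p * q `^ p = 1.
  by rewrite -powRM ?invr_ge0 ?(ltW q0)// mulVf ?powR1// gt_eqF.
have qq := @mulr_powRB1 _ q p (ltW q0) p0.
by apply: (mulfI (lt0r_neq0 q0)); rewrite mulrCA qq qp divff// gt_eqF.
Qed.

End mollifier.

(** * The local estimate *)

Section local_estimate.
Variables (R : realType) (N : nat).
Local Notation mu := (lebesgue_rv R N).
Implicit Types (Omega : set 'rV[R]_N) (u v : 'rV[R]_N -> R).
Implicit Types (x y h b c : 'rV[R]_N) (a t k p : R).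

Lemma measurable_near_diag p u a : measurable_fun setT u ->
  measurable_fun setT (fun q : 'rV[R]_N * 'rV[R]_N =>
    (near_diag a q * `|u q.1 - u q.2| `^ p)%:E).
Proof.
move=> mu_; apply/measurable_EFinP; apply: measurable_funM; last exact: measurable_diff_powR.
rewrite (_ : near_diag a = \1_[set z | enorm (z.1 - z.2) <= a]); last first.
  apply/funext => z; rewrite indicE /near_diag.
  by case: (boolP (enorm (z.1 - z.2) <= a)) => H;
    [rewrite mem_set|rewrite memNset//; exact/negP].
by apply: measurable_indic; apply: measurable_le_set => //; exact: measurable_enormB.
Qed.

Lemma near_energy_ge0 p u a x z : 0 <= near_diag a (x, z) * `|u x - u z| `^ p.
Proof. by rewrite mulr_ge0 ?powR_ge0// /near_diag ler0n. Qed.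

Lemma local_energyE p u a : measurable_fun setT u ->
  (local_energy p u a =
   \int[mu]_x \int[mu]_z (near_diag a (x, z) * `|u x - u z| `^ p)%:E)%E.
Proof.
move=> mu_; rewrite /local_energy fubini_tonelli1; first by [].
  exact: measurable_near_diag.
by move=> -[x z]; rewrite lee_fin; exact: near_energy_ge0.
Qed.

Section small_scale.
Variables (t k a p : R) (b : 'rV[R]_N) (Omega : set 'rV[R]_N) (u : 'rV[R]_N -> R).
Hypotheses (t0 : 0 < t) (k1 : 1 <= k) (p1 : 1 < p) (mO : measurable Omega)
  (tu : test_fun u).
(** The integral estimates of this section see the geometry of the domain only through this bound on
    displacements. *)
Hypothesis disp : forall x y, Omega x -> `|y| <= 3 * t ->
  enorm (x - (k *: (x + y) + b)) <= a.

Let osc x : \bar R :=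
  (\int[mu]_y (cube_ind (3 * t) y * `|u (k *: (x + y) + b) - u x| `^ p)%:E)%E.

Let mosc_arg : measurable_fun setT (fun q : 'rV[R]_N * 'rV[R]_N =>
  (cube_ind (3 * t) q.2 * `|u (k *: (q.1 + q.2) + b) - u q.1| `^ p)%:E).
Proof.
have mu_ := test_fun_measurable tu.
apply/measurable_EFinP; apply: measurable_funM.
  exact: (measurableT_comp (@measurable_cube_ind R N (3 * t)) measurable_snd).
apply/measurable_EFinP; apply: measurable_abs_powR; apply: measurable_funB.
  apply: (measurableT_comp mu_); apply: measurable_fun_rvD => //.
  apply: measurable_fun_rvZ; apply: measurable_fun_rvD.
    exact: measurable_fst.
  exact: measurable_snd.
exact: (measurableT_comp mu_ measurable_fst).
Qed.

Let osc_arg_ge0 x y : (0 <= (cube_ind (3 * t) y * `|u (k *: (x + y) + b) - u x| `^ p)%:E)%E.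
Proof. by rewrite lee_fin mulr_ge0 ?cube_ind_ge0 ?powR_ge0. Qed.

Let mosc : measurable_fun setT osc.
Proof. exact: (measurable_integral_in mu measurableT mosc_arg (fun x y _ => osc_arg_ge0 x y)). Qed.

Let osc0 x : (0 <= osc x)%E.
Proof. by apply: integral_ge0 => y _; exact: osc_arg_ge0. Qed.

Lemma integral_oscillation_le :
  (\int[mu]_(x in Omega) osc x <= local_energy p u a)%E.
Proof.
have mu_ := test_fun_measurable tu; have mn := measurable_near_diag p a mu_.
have k0 : 0 < k by exact: lt_le_trans k1.
rewrite (local_energyE _ _ mu_).
pose f x z : \bar R := (near_diag a (x, z) * `|u x - u z| `^ p)%:E.
have f0 x z : (0 <= f x z)%E by rewrite lee_fin near_energy_ge0.
have mF : measurable_fun setT (fun x => \int[mu]_z f x z)%E.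
  exact: (measurable_integral_in mu measurableT mn (fun x y _ => f0 x y)).
apply: (@le_trans _ _ (\int[mu]_(x in Omega) \int[mu]_z f x z)%E); last first.
  by apply: ge0_subset_integral => // x _; exact: integral_ge0.
have mo' : measurable_fun Omega osc := measurable_funTS mosc.
have mF' : measurable_fun Omega (fun x => \int[mu]_z f x z)%E := measurable_funTS mF.
have H := ge0_le_integral mu mO (fun x _ => osc0 x) mo' mF'.
apply: H => x Ox.
have mfx : measurable_fun setT (f x).
  exact: (measurableT_comp mn (measurable_pair1 x)).
(* Substitution [z = k *: (x + y) + b] on the larger side; its Jacobian [k ^+ N] is at least 1
   because [k >= 1], and is then dropped. *)
rewrite (ge0_integral_rv_affine (k *: x + b) k0 mfx)//.
pose G y := f x (k *: y + (k *: x + b)).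
apply: (@le_trans _ _ (\int[mu]_y G y)%E); last first.
  rewrite -[leLHS]mul1e; apply: lee_wpmul2r.
    by apply: integral_ge0 => y _; exact: f0.
  by rewrite lee_fin exprn_ege1.
apply: ge0_le_integral => //.
- exact: (measurableT_comp mosc_arg (measurable_pair1 x)).
- exact: (measurableT_comp mfx (@measurable_rv_affine R N k (k *: x + b))).
move=> y _; rewrite /G /f lee_fin.
rewrite (_ : k *: y + (k *: x + b) = k *: (x + y) + b); last first.
  by rewrite scalerDr addrA [k *: x + k *: y]addrC.
rewrite distrC; apply: ler_wpM2r; first exact: powR_ge0.
rewrite /cube_ind /near_diag ler_nat /=; case: (leP `|y| (3 * t)) => // yt.
by rewrite disp.
Qed.

Lemma K_functional_mollify : C0oo Omega (mollify t k b u) ->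
  (K_functional p Omega t u `^ p <=
   (2 `^ p * (2 `^ p + N%:R `^ p) * (3 ^+ N) `^ (p - 1) / t ^+ N)%:E *
   local_energy p u a)%E.
Proof.
move=> Cv; set v := mollify t k b u in Cv *.
have tv := C0oo_test_fun Cv.
have mu_ := test_fun_measurable tu; have mv := test_fun_measurable tv.
have p0 : 0 < p := lt_trans ltr01 p1.
pose cc : R := (3 ^+ N) `^ (p - 1) / (2 * t) ^+ N.
have cc0 : 0 <= cc by rewrite divr_ge0 ?powR_ge0// exprn_ge0// mulr_ge0// ltW.
(* Both terms of the K-functional are instances: [n = 2] for [u - v], and [n = N] for [t] times the
   gradient of [v]. *)
have bound (f : 'rV[R]_N -> R) (n : R) : measurable_fun setT f -> 0 <= n ->
    (forall x, `|f x| <= n * ((bump_mass N t)^-1 * oscillation t k b u x)) ->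
    (\int[mu]_(x in Omega) (`|f x| `^ p)%:E <=
     (n `^ p * cc)%:E * local_energy p u a)%E.
  move=> mf n0 fn.
  apply: (@le_trans _ _ ((n `^ p * cc)%:E * \int[mu]_(x in Omega) osc x)%E); last first.
    apply: lee_wpmul2l; last exact: integral_oscillation_le.
    by rewrite lee_fin mulr_ge0// powR_ge0.
  rewrite -ge0_integralZl_EFin//; last 2 first.
  - exact: measurable_funTS.
  - by rewrite mulr_ge0// powR_ge0.
  apply: ge0_le_integral => //.
  - by apply: measurable_funTS; exact: measurable_abs_powR.
  - by apply: measurable_funeM; exact: measurable_funTS.
  move=> x _.
  have A0 : 0 <= (bump_mass N t)^-1 * oscillation t k b u x.
    rewrite mulr_ge0 ?oscillation_ge0// invr_ge0.
    by apply: le_trans (bump_mass_ge N t0); rewrite exprn_ge0// mulr_ge0// ltW.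
  apply: (@le_trans _ _ ((n `^ p)%:E *
     (((bump_mass N t)^-1 * oscillation t k b u x) `^ p)%:E)%E).
    rewrite -EFinM lee_fin -powRM//.
    by apply: ler_powR_base; [exact: ltW|exact: normr_ge0|exact: fn].
  rewrite EFinM -muleA; apply: lee_wpmul2l; first by rewrite lee_fin powR_ge0.
  exact: oscillation_powR.
have H1 : (Lp_norm p Omega (u \- v)%R `^ p <=
    (2 `^ p * cc)%:E * local_energy p u a)%E.
  rewrite Lp_norm_poweR//; apply: bound => //; first exact: measurable_funB.
  by move=> x; exact: mollify_dist.
have H2 : ((t%:E * Lp_norm p Omega (fun x => enorm (gradient v x))) `^ p <=
    (N%:R `^ p * cc)%:E * local_energy p u a)%E.
  have tp : (0 <= (t `^ p)%:E)%E by rewrite lee_fin powR_ge0.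
  have mgr := measurable_gradient_norm tv.
  rewrite poweRM ?Lp_norm_ge0 ?lee_fin ?(ltW t0)// Lp_norm_poweR//.
  rewrite poweR_EFin -ge0_integralZl_EFin ?powR_ge0//; last first.
    by apply: measurable_funTS; exact: measurable_abs_powR.
  rewrite (eq_integral (fun x => (`|t * enorm (gradient v x)| `^ p)%:E)); last first.
    by move=> x _; rewrite -EFinM normrM powRM// (gtr0_norm t0).
  apply: bound => //; first exact: measurable_funM.
  move=> x; rewrite ger0_norm; last by rewrite mulr_ge0 ?enorm_ge0// ltW.
  exact: mollify_gradient.
apply: (@le_trans _ _ ((2 `^ p)%:E * (((2 `^ p + N%:R `^ p) * cc)%:E *
    local_energy p u a))%E).
  apply: le_trans (lee_poweR_base (ltW p0) (K_functional_ge0 _ _ _ (ltW t0))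
    (K_functional_le p t u Cv)) _.
  apply: le_trans (poweRD_le (ltW p0) (Lp_norm_ge0 _ _ _) _) _.
    by rewrite mule_ge0 ?Lp_norm_ge0// lee_fin ltW.
  apply: lee_wpmul2l; first by rewrite lee_fin powR_ge0.
  rewrite mulrDl EFinD ge0_muleDl ?lee_fin; [exact: leeD|by rewrite mulr_ge0 ?powR_ge0|by rewrite mulr_ge0 ?powR_ge0].
rewrite muleA -EFinM; apply: lee_wpmul2r.
  by apply: integral_ge0 => z _; rewrite lee_fin mulr_ge0 ?powR_ge0// /near_diag ler0n.
rewrite lee_fin -!mulrA; apply: ler_wpM2l; first exact: powR_ge0.
apply: ler_wpM2l; first by rewrite addr_ge0// powR_ge0.
rewrite /cc; apply: ler_wpM2l; first exact: powR_ge0.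
have tN : 0 < t ^+ N by exact: exprn_gt0.
apply: (ler_inv_anti tN); rewrite lerXn2r ?nnegrE ?(ltW t0)//; first by rewrite mulr_ge0// ltW.
by rewrite mulr_natl mulr2n lerDl ltW.
Qed.

End small_scale.

Lemma compact_cube a : compact [set y : 'rV[R]_N | `|y| <= a].
Proof.
apply: bounded_closed_compact.
  exists a; split; first exact: num_real.
  by move=> M aM y /= ya; exact: le_trans ya (ltW aM).
rewrite (_ : [set _ | _] = (fun y : 'rV[R]_N => `|y|) @^-1` [set r | r <= a])//.
by apply: closed_comp; [move=> y _; exact: norm_continuous|exact: closed_le].
Qed.

(* [x |-> k x + (1 - k) x0] with [k = (1 - th)^-1] is the dilation about [x0]. *)
Lemma mollify_C0oo Omega u t x0 (r th : R) : 0 < t -> convex_set Omega ->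
  (forall y, enorm (y - x0) < r -> Omega y) ->
  0 < th -> th < 1 -> N%:R * (2 * t) < th * r -> C0oo Omega u ->
  C0oo Omega (mollify t (1 - th)^-1 ((1 - (1 - th)^-1) *: x0) u).
Proof.
move=> t0 cO xr th0 th1 tr Cu; have tu := C0oo_test_fun Cu.
have [_ cu uO] := Cu.
have th1' : 1 - th != 0 by rewrite subr_eq0 gt_eqF.
set k := (1 - th)^-1; set b := _ *: x0; set v := mollify _ _ _ _.
(* Solving [w = k *: (x + y) + b] for [x] gives [x = phi (w, y)]: the support of [v] lies in a
   continuous image of a compact set. *)
pose phi (z : 'rV[R]_N * 'rV[R]_N) : 'rV[R]_N := (1 - th) *: z.1 + (th *: x0 - z.2).
pose T := phi @` (tsupport u `*` [set y : 'rV[R]_N | `|y| <= 2 * t]).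
have cT : compact T.
  have cP := compact_setX cu (@compact_cube (2 * t)).
  apply: (continuous_compact _ cP).
  apply: continuous_subspaceT => z; apply: cvgD.
    by apply: cvgZr; exact: cvg_fst.
  by apply: cvgB; [exact: cvg_cst|exact: cvg_snd].
have TO : T `<=` Omega.
  move=> _ [[w y] [/= wu yt] <-].
  (* The shift by [y] is absorbed in the centre: the point is a convex combination of [w] and of
     [x0 - th^-1 *: y], which stays in the ball of radius [r] about [x0]. *)
  rewrite (_ : phi _ = (1 - th) *: w + (1 - (1 - th)) *: (x0 - th^-1 *: y)); last first.
    by rewrite /phi /= subKr scalerBr scalerA mulfV ?scale1r// gt_eqF.
  apply: convex_segment => //; [exact: uO| |by apply/andP; split; lra].
  apply: xr; rewrite addrAC subrr add0r enormN enormZ normfV (gtr0_norm th0).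
  rewrite ltr_pdivrMl//; apply: le_lt_trans tr.
  by apply: le_trans (enorm_le_normr _) _; apply: ler_wpM2l.
have vT : tsupport v `<=` T.
  have -> : T = closure T by apply/closure_id; exact: compact_closed.
  apply: closureS => x /= vx.
  have [y ry uy] := conv_neq0 vx.
  exists (k *: (x + y) + b, y) => /=.
    split => /=; first exact: subset_closure.
    rewrite leNgt; apply: contra_neqN ry => yt.
    by rewrite bump_out ?mulr0.
  apply/rowP => i; rewrite /phi /= /b /k !mxE; field.
  by [].
split.
- exact: (conv_smooth _ _ (kernel_funZ _ (bump_kernel N t0)) tu).
- by apply: subclosed_compact cT vT; exact: closed_closure.
- exact: subset_trans vT TO.
Qed.

Lemma C0oo0 Omega : C0oo Omega (fun _ : 'rV[R]_N => 0).
Proof.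
have E : [set x : 'rV[R]_N | (0 : R) != 0] = set0.
  by apply/seteqP; split => // x /=; rewrite eqxx.
split.
- move=> n; elim: n => [|n ih]; first by move=> x; exact: cst_continuous.
  split; [by move=> x; exact: cst_continuous|by move=> i x; exact: derivable_cst|].
  move=> i; rewrite (_ : partial_deriv i _ = fun _ => 0)//.
  by apply/funext => x; rewrite /partial_deriv derive_cst.
- by rewrite /tsupport E closure0; exact: compact0.
- by rewrite /tsupport E closure0.
Qed.

Lemma K_functional_le_Lp p Omega t u : 1 < p -> 0 < t ->
  (K_functional p Omega t u `^ p <= \int[mu]_(x in Omega) (`|u x| `^ p)%:E)%E.
Proof.
move=> p1 t0; have p0 : 0 < p by lra.
rewrite -Lp_norm_poweR//; apply: lee_poweR_base; first exact: ltW.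
  exact/K_functional_ge0/ltW.
apply: le_trans (K_functional_le p t u (C0oo0 Omega)) _.
rewrite (_ : u \- _ = u); last by apply/funext => x; rewrite /= subr0.
rewrite (_ : Lp_norm p Omega (fun x => enorm (gradient (fun=> 0) x)) = 0%E).
  by rewrite mule0 adde0.
rewrite (_ : (fun x => _) = cst 0); last first.
  apply/funext => x; rewrite /enorm big1 ?sqrtr0// => i _.
  by rewrite mxE /partial_deriv derive_cst expr0n.
rewrite /Lp_norm (_ : (EFin \o cst 0) \_ Omega = cst 0%E) ?Lnorm0//.
  by rewrite eqe gt_eqF.
by apply/funext => x; rewrite patchE; case: ifPn.
Qed.

(** Every [z] in the cube of half-width [a] about [x + c] lies outside [Omega], so that
    [u x = u x - u z]; averaging over this cube divides by its measure. *)
Lemma Lp_le_local_energy p Omega u a M : (0 < N)%N -> 1 < p -> 0 < a ->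
  measurable Omega -> measurable_fun setT u -> (forall x, ~ Omega x -> u x = 0) ->
  (forall x y, Omega x -> Omega y -> enorm (x - y) < 2 * a) ->
  N%:R * (4 * a) <= M ->
  (\int[mu]_(x in Omega) (`|u x| `^ p)%:E <=
   (((2 * a) ^+ N)^-1)%:E * local_energy p u M)%E.
Proof.
move=> N0 p1 a0 mO mu_ uO dO aM.
have q0 : 0 < (2 * a) ^+ N by rewrite exprn_gt0// mulr_gt0.
have mn := measurable_near_diag p M mu_.
rewrite muleC lee_pdivlMr// muleC (local_energyE _ _ mu_).
(* All coordinates of [z - x] then lie between [2 * a] and [4 * a]: the lower bound exceeds every
   distance in [Omega], the upper one keeps the pair within range [M]. *)
pose c : 'rV[R]_N := const_mx (3 * a).
pose f x z : \bar R := (near_diag M (x, z) * `|u x - u z| `^ p)%:E.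
have f0 x z : (0 <= f x z)%E by rewrite lee_fin near_energy_ge0.
have mF : measurable_fun setT (fun x => \int[mu]_z f x z)%E.
  exact: (measurable_integral_in mu measurableT mn (fun x y _ => f0 x y)).
apply: (@le_trans _ _ (\int[mu]_(x in Omega) \int[mu]_z f x z)%E); last first.
  by apply: ge0_subset_integral => // x _; exact: integral_ge0.
rewrite -ge0_integralZl_EFin ?(ltW q0)//; last first.
  by apply: measurable_funTS; exact: measurable_abs_powR.
apply: ge0_le_integral => //.
- by move=> x _; rewrite -EFinM lee_fin mulr_ge0 ?powR_ge0// ltW.
- by apply: measurable_funTS; apply: measurable_funeM; exact: measurable_abs_powR.
- exact: measurable_funTS.
move=> x Ox.
have mfx : measurable_fun setT (f x).
  exact: (measurableT_comp mn (measurable_pair1 x)).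
rewrite -(integral_rvD (x + c) mfx) -integral_cube_ind ?(ltW a0)//.
rewrite muleC -ge0_integralZl_EFin ?powR_ge0//; last 2 first.
- by move=> y _; rewrite lee_fin cube_ind_ge0.
- by apply/measurable_EFinP; exact: measurable_cube_ind.
apply: ge0_le_integral => //.
- by move=> y _; rewrite -EFinM lee_fin mulr_ge0 ?powR_ge0 ?cube_ind_ge0.
- apply: measurable_funeM; apply/measurable_EFinP; exact: measurable_cube_ind.
- exact: (measurableT_comp mfx (measurable_fun_rvD (@measurable_id _ _ _) (@measurable_cst _ _ _ _ _ _))).
move=> y _; rewrite -EFinM lee_fin /cube_ind.
case: (leP `|y| a) => ya /=; last by rewrite mulr0 near_energy_ge0.
have yi i : 2 * a <= (y + c) ord0 i <= 4 * a.
  have := le_trans (ler_coord_norm y i) ya; rewrite ler_norml !mxE => /andP[h1 h2].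
  by apply/andP; split; lra.
rewrite mulr1 (_ : u (y + (x + c)) = 0) ?subr0; last first.
  apply: uO => Oz; have := dO _ _ Oz Ox; rewrite addrCA addrAC subrr add0r.
  apply/negP; rewrite -leNgt; apply: le_trans (normr_le_enorm _).
  apply: le_trans (ler_coord_norm _ (Ordinal N0)).
  by have /andP[h _] := yi (Ordinal N0); exact: le_trans h (ler_norm _).
rewrite /near_diag /= (_ : _ <= M) ?mul1r//.
rewrite addrCA opprD addrA subrr sub0r enormN.
apply: le_trans aM; apply: le_trans (enorm_le_normr _) _; apply: ler_wpM2l => //.
apply: rv_norm_le; first by rewrite mulr_ge0// ltW.
by move=> i; have /andP[h1 h2] := yi i; rewrite ger0_norm//; lra.
Qed.

End local_estimate.

(** * Small and large scales in a convex domain *)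

Section convex_domain.
Variables (R : realType) (N : nat) (p : R).
Local Notation mu := (lebesgue_rv R N).
Implicit Types (Omega : set 'rV[R]_N) (u : 'rV[R]_N -> R) (t e : R).

(** The first summand serves the mollified competitor at small scales, the 1 serves the zero
    competitor at large ones. *)
Definition local_factor : R :=
  2 `^ p * (2 `^ p + N%:R `^ p) * (3 ^+ N) `^ (p - 1) + 1.

(** [N * (4 * a) / t] for the half-width [a] chosen at large scales; it also exceeds the
    displacement at small ones. The last 1 and the absolute value make it at least 1 for every real
    [e], so the final constant is positive at all arguments. *)
Definition local_range e : R := N%:R * (4 * (32 * N%:R * `|e| + 2)) + 1.

Lemma local_factor_gt0 : 0 < local_factor.
Proof. by rewrite ltr_wpDl// mulr_ge0 ?powR_ge0// mulr_ge0 ?addr_ge0 ?powR_ge0. Qed.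

Lemma local_range_ge1 e : 1 <= local_range e.
Proof. by rewrite lerDr !mulr_ge0// addr_ge0// !mulr_ge0. Qed.

Lemma local_factor_le (c t : R) a u : 0 < t -> c <= local_factor ->
  ((c / t ^+ N)%:E * local_energy p u a <=
   (local_factor * (t ^+ N)^-1)%:E * local_energy p u a)%E.
Proof.
move=> t0 cl; apply: lee_wpmul2r.
  by apply: integral_ge0 => -[x z] _; rewrite lee_fin; exact: near_energy_ge0.
by rewrite lee_fin; apply: ler_wpM2r => //; rewrite invr_ge0 exprn_ge0// ltW.
Qed.

Lemma K_functional_small Omega u (x0 : 'rV[R]_N) (r E t : R) : (0 < N)%N -> 1 < p ->
  0 < r -> 0 < t -> 16 * N%:R * t <= r -> open Omega -> convex_set Omega ->
  Omega x0 -> (forall y, enorm (y - x0) < r / 2 -> Omega y) ->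
  (forall x, Omega x -> enorm (x - x0) <= 2 * r * E) -> C0oo Omega u ->
  (K_functional p Omega t u `^ p <=
   (local_factor * (t ^+ N)^-1)%:E *
   local_energy p u (N%:R * ((32 * N%:R * E + 6) * t)))%E.
Proof.
move=> N0 p1 r0 t0 tr oO cO Ox0 xr dO Cu.
have n0 : 0 < N%:R :> R by rewrite ltr0n.
(* The free ball has radius [r / 2], and [th * (r / 2)] is [4 * N * t], twice the margin that
   [mollify_C0oo] requires; the smallness of [t] gives [th <= 1 / 2], so the ratio of the dilation
   is at most 2. *)
pose th : R := 8 * t * N%:R / r.
have th0 : 0 < th by rewrite divr_gt0// !mulr_gt0.
have th2 : th <= 2^-1.
  by rewrite /th ler_pdivrMr//; lra.
have th1 : 0 < 1 - th by lra.
have kE : (1 - th)^-1 - 1 = th * (1 - th)^-1 by field; rewrite gt_eqF.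
have k2 : (1 - th)^-1 <= 2.
  by rewrite -[leRHS]invrK; apply: ler_inv_anti; lra.
have k1 : 1 <= (1 - th)^-1 by rewrite invf_ge1//; lra.
have Cv : C0oo Omega (mollify t (1 - th)^-1 ((1 - (1 - th)^-1) *: x0) u).
  apply: (mollify_C0oo t0 cO xr th0 _ _ Cu); first by lra.
  have -> : th * (r / 2) = 4 * (N%:R * t) by rewrite /th; field; rewrite gt_eqF.
  have nt : 0 < N%:R * t by exact: mulr_gt0.
  lra.
apply: le_trans (K_functional_mollify (a := N%:R * ((32 * N%:R * E + 6) * t))
   t0 k1 p1 (open_measurable_rv oO) (C0oo_test_fun Cu) _ Cv) _; last first.
  by apply: local_factor_le => //; rewrite /local_factor lerDl.
move=> x y Ox y3; apply: le_trans (enorm_le_normr _) _; apply: ler_wpM2l => //.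
set k := (1 - th)^-1 in kE k2 k1 *.
have -> : x - (k *: (x + y) + (1 - k) *: x0) = - ((k - 1) *: (x - x0) + k *: y).
  by apply/rowP => i; rewrite !mxE; ring.
rewrite normrN; apply: le_trans (ler_normD _ _) _; rewrite !normrZ.
have k0 : 0 <= k - 1 by rewrite subr_ge0.
rewrite (ger0_norm k0) (ger0_norm (le_trans ler01 k1)) [leRHS]mulrDl; apply: lerD.
  have xx := le_trans (normr_le_enorm _) (dO x Ox).
  have rE0 : 0 <= 2 * r * E := le_trans (normr_ge0 _) xx.
  apply: le_trans (ler_wpM2l k0 xx) _.
  (* Since [k - 1 <= 2 * th] and [th] is a multiple of [t / r], the radius cancels against the bound
     [2 * r * E] on distances to [x0]; only [E] remains. *)
  have -> : 32 * N%:R * E * t = (2 * th) * (2 * r * E) by rewrite /th; field; rewrite gt_eqF.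
  apply: ler_wpM2r => //; rewrite kE mulrC; apply: ler_wpM2r => //; exact: ltW.
have -> : 6 * t = 2 * (3 * t) by ring.
by apply: ler_pM => //; exact: le_trans k1.
Qed.

Lemma local_energy_mono u (a b : R) : measurable_fun setT u -> a <= b ->
  (local_energy p u a <= local_energy p u b)%E.
Proof.
move=> mu_ ab; apply: ge0_le_integral => //.
- by move=> -[x z] _; rewrite lee_fin; exact: near_energy_ge0.
- exact: measurable_near_diag.
- exact: measurable_near_diag.
move=> z _; rewrite lee_fin; apply: ler_wpM2r; first exact: powR_ge0.
rewrite /near_diag ler_nat; case: (leP (enorm (z.1 - z.2)) a) => // za.
by rewrite (le_trans za ab).
Qed.

Lemma K_functional_local Omega u t : (0 < N)%N -> 1 < p ->
  open Omega -> bounded_set Omega -> convex_set Omega -> C0oo Omega u -> 0 < t ->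
  (K_functional p Omega t u `^ p <=
   (local_factor * (t ^+ N)^-1)%:E *
   local_energy p u (local_range (eccentricity Omega) * t))%E.
Proof.
move=> N0 p1 oO bO cO Cu t0.
have mu_ := test_fun_measurable (C0oo_test_fun Cu).
have mO := open_measurable_rv oO.
have e0 a : (0 <= local_energy p u a)%E.
  by apply: integral_ge0 => -[x z] _; rewrite lee_fin; exact: near_energy_ge0.
(* An empty domain has no centre; there the zero competitor already makes the K-functional
   vanish. *)
have [E0|nO] := eqVneq Omega set0.
  apply: le_trans (K_functional_le_Lp Omega u p1 t0) _.
  rewrite {1}E0 integral_set0; apply: mule_ge0 => //.
  by rewrite lee_fin mulr_ge0 ?invr_ge0 ?exprn_ge0// ltW// local_factor_gt0.
have [r0 [x0 Ox0 xr]] := inradius_center N0 oO bO (iffLR (set0P _) nO).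
set r := inradius Omega in r0 xr; set e := eccentricity Omega.
have n0 : 0 < N%:R :> R by rewrite ltr0n.
have dE x y : Omega x -> Omega y -> enorm (x - y) <= 2 * r * `|e|.
  move=> Ox Oy; apply: le_trans (diam_ub bO Ox Oy) _.
  have -> : diam Omega = 2 * r * e.
    by rewrite /e /eccentricity -/r; field; rewrite gt_eqF.
  by apply: ler_wpM2l (ler_norm _); rewrite mulr_ge0// ltW.
have [tr|tr] := leP (16 * N%:R * t) r.
  apply: le_trans (K_functional_small N0 p1 r0 t0 tr oO cO Ox0 xr
    (fun x Ox => dE x x0 Ox Ox0) Cu) _.
  apply: lee_wpmul2l.
    by rewrite lee_fin mulr_ge0 ?invr_ge0 ?exprn_ge0// ltW// local_factor_gt0.
  apply: local_energy_mono => //; rewrite mulrA; apply: ler_wpM2r; first exact: ltW.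
  have ne0 : 0 <= N%:R * `|e| by exact: mulr_ge0.
  rewrite /local_range ler_wpDr//.
  by apply: ler_wpM2l => //; lra.
apply: le_trans (K_functional_le_Lp Omega u p1 t0) _.
(* Now [r < 16 * N * t], so distances in [Omega] are at most [32 * N * |e| * t], which is below
   [2 * a]. The summand 2 gives strictness and [t <= a]. *)
pose a : R := (32 * N%:R * `|e| + 2) * t.
have ne0 : 0 <= N%:R * `|e| by exact: mulr_ge0.
have net : 0 <= N%:R * `|e| * t by rewrite mulr_ge0// ltW.
have at_ : t <= a by rewrite /a -[leLHS]mul1r ler_pM2r//; lra.
have a0 : 0 < a := lt_le_trans t0 at_.
apply: le_trans (Lp_le_local_energy (a := a)
  (M := local_range e * t) N0 p1 a0 mO mu_ _ _ _) _.
- by move=> x; exact: C0oo_out.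
- move=> x y Ox Oy; apply: le_lt_trans (dE _ _ Ox Oy) _.
  have : r * `|e| <= 16 * N%:R * t * `|e| by apply: ler_wpM2r => //; exact: ltW.
  by rewrite /a; lra.
- have -> : local_range e * t = N%:R * (4 * a) + t by rewrite /local_range /a; ring.
  by rewrite lerDl ltW.
apply: lee_wpmul2r => //; rewrite lee_fin.
rewrite -[leLHS]mul1r; apply: ler_pM => //.
- by rewrite invr_ge0 exprn_ge0// mulr_ge0// ltW.
- by rewrite lerDr mulr_ge0 ?powR_ge0// mulr_ge0 ?addr_ge0 ?powR_ge0.
have tN : 0 < t ^+ N by exact: exprn_gt0.
apply: (ler_inv_anti tN); rewrite lerXn2r ?nnegrE ?(ltW t0)//.
  by rewrite mulr_ge0// ltW.
lra.
Qed.

End convex_domain.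

Lemma le_norm_of_powers (R : realType) (p c : R) (x y : \bar R) : 1 < p -> 0 < c ->
  (0 <= x)%E -> (0 <= y)%E -> (x `^ p <= c%:E * y `^ p)%E ->
  (x <= (c `^ p^-1)%:E * y)%E.
Proof.
move=> p1 c0 x0 y0 xy; have p0 : 0 < p by lra.
apply: (lee_poweR_inv p0 x0); first by rewrite mule_ge0// lee_fin powR_ge0.
rewrite poweRM ?lee_fin ?powR_ge0// poweR_EFin -powRrM mulVf ?gt_eqF//.
by rewrite powRr1// ltW.
Qed.

Theorem theorem4p7 (R : realType) :
  exists C : nat -> R -> R -> R,
    (forall (N : nat) (p e : R), 0 < C N p e) /\
    forall (N : nat) (p s : R) (Omega : set 'rV[R]_N),
      (0 < N)%N -> 1 < p -> 0 < s -> s < 1 ->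
      open Omega -> bounded_set Omega -> convex_set Omega ->
      (forall u : 'rV[R]_N -> R, C0oo Omega u ->
        (Xsp_norm s p Omega u `^ p <=
           (C N p (eccentricity Omega))%:E * Dsp_norm s p u `^ p)%E) /\
      equivalent_norms (C0oo Omega) (Xsp_norm s p Omega) (Dsp_norm s p).
Proof.
pose C N p (e : R) : R := local_factor N p * local_range N e `^ (N%:R + p).
have C0 N p e : 0 < C N p e.
  rewrite mulr_gt0 ?local_factor_gt0// powR_gt0//.
  exact: lt_le_trans ltr01 (local_range_ge1 N e).
exists C; split=> // N p s Omega N0 p1 s0 s1 oO bO cO.
have XD u : C0oo Omega u -> (Xsp_norm s p Omega u `^ p <=
    (C N p (eccentricity Omega))%:E * Dsp_norm s p u `^ p)%E.
  move=> Cu; apply: Xsp_le_Dsp_of_local => //.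
  - exact: local_factor_gt0.
  - exact: local_range_ge1.
  - exact: test_fun_measurable (C0oo_test_fun Cu).
  by move=> t t0; exact: K_functional_local.
split=> //.
have [c c0 DX] := Dsp_le_Xsp N s0 p1.
set c1 := C N p (eccentricity Omega) in XD.
(* One constant must serve both inequalities; the sum dominates each p-th root. *)
exists (c1 `^ p^-1 + c `^ p^-1); first by rewrite addr_gt0// powR_gt0// C0.
move=> u Cu; have X0 := Xsp_norm_ge0 s p Omega u; have D0 := Dsp_norm_ge0 s p u.
split.
  apply: le_trans (le_norm_of_powers p1 (C0 _ _ _) X0 D0 (XD _ Cu)) _.
  by apply: lee_wpmul2r => //; rewrite lee_fin lerDl powR_ge0.
apply: le_trans (le_norm_of_powers p1 c0 D0 X0 (DX _ _ Cu)) _.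
by apply: lee_wpmul2r => //; rewrite lee_fin lerDr powR_ge0.
Qed.
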